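(* Let $v_1,\ldots,v_n\in\mathbb{Z}^2$, let $\mathcal{A}$ be the corresponding toric arrangement with special vertex and $(c_{i,j})_{i,j}$ the Plücker matrix, and for $1\le i_1,\ldots,i_k\le n$ let $$d_{i_1,\ldots,i_k}:=\operatorname{vol}(v_{i_1},\ldots,v_{i_k}):=\gcd\{ c_{i,j} \mid i,j\in\{i_1,\ldots,i_k\}\}.$$ Then $\mathcal{A}$ is simplicial if and only if $$\sum_{k\ge 2}\ \sum_{1\le i_1<\cdots<i_k\le n} (-1)^{k+1}(2k-3)\, d_{i_1,\ldots,i_k} = 0.$$
   Context: Let $e_1,e_2,e_3$ be the standard basis of $\mathbb{R}^3$ and identify $\mathbb{R}^2$ with $\langle e_1,e_2\rangle\subset\mathbb{R}^3$. For $v\in\mathbb{R}^3$, $v^\perp$ denotes the orthogonal complement of $v$ with respect to the standard inner product. The toric arrangement with special vertex corresponding to $v_1,\ldots,v_n$ is $$\mathcal{A}=\{(v_i+k e_3)^\perp \mid i=1,\ldots,n,\ k\in\mathbb{Z}\}\cup\{e_3^\perp\}.$$ It is called simplicial if the connected components of the complement of $\mathcal{A}$ in the open half space $\{(x_1,x_2,x_3)\in\mathbb{R}^3\mid x_3>0\}$ are open simplicial cones. The Plücker matrix of $v_1,\ldots,v_n$ is the matrix $(c_{i,j})_{1\le i,j\le n}$ with $c_{i,j}:=\det(v_i\,v_j)$, the determinant of the $2\times 2$ matrix with columns $v_i,v_j$. Greatest common divisors are taken to be nonnegative.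
   Formalization: The formal statement adds n ≥ 2 and that v_1,…,v_n are pairwise linearly independent (c_{i,j} ≠ 0 for i ≠ j). Without this the claim fails: for (1,0), (2,0), (0,1) the sum is 0 but the chambers are cones over rectangles. *)

(* Defs.v *)
From HB Require Import structures.
From mathcomp Require Import all_boot all_order all_algebra.
From mathcomp Require Import all_classical all_reals all_analysis.

Set Implicit Arguments.
Unset Strict Implicit.
Unset Printing Implicit Defensive.

Import Order.TTheory GRing.Theory Num.Theory.
Import numFieldNormedType.Exports.

Local Open Scope classical_set_scope.
Local Open Scope ring_scope.

Section Arrangement.
Variable R : realType.

Definition std_basis (i : 'I_3) : 'cV[R]_3 := delta_mx i 0.

Definition e1 : 'cV[R]_3 := std_basis 0.
Definition e2 : 'cV[R]_3 := std_basis 1.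
Definition e3 : 'cV[R]_3 := std_basis ord_max.

Definition embed_plane (v : 'cV[R]_2) : 'cV[R]_3 := v 0 0 *: e1 + v 1 0 *: e2.

Definition inner (x y : 'cV[R]_3) : R := \sum_(i < 3) x i 0 * y i 0.

Definition perp (v : 'cV[R]_3) : set 'cV[R]_3 := [set x | inner v x = 0].

Definition toric_arrangement (n : nat) (v : 'I_n -> 'cV[R]_2) :
    set (set 'cV[R]_3) :=
  [set H | exists (i : 'I_n) (k : int),
     H = perp (embed_plane (v i) + k%:~R *: e3)]
  `|` [set perp e3].

Definition open_half_space : set 'cV[R]_3 := [set x | 0 < x ord_max 0].

Definition half_space_complement (A : set (set 'cV[R]_3)) : set 'cV[R]_3 :=
  open_half_space `\` \bigcup_(H in A) H.

Definition open_simplicial_cone (C : set 'cV[R]_3) : Prop :=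
  exists2 w : 'M[R]_3, w \in unitmx &
    C = [set x | exists2 a : 'I_3 -> R,
                   forall i, 0 < a i & x = \sum_(i < 3) a i *: col i w].

Definition simplicial (A : set (set 'cV[R]_3)) : Prop :=
  forall x, half_space_complement A x ->
    open_simplicial_cone (connected_component (half_space_complement A) x).

End Arrangement.

(* Relating simpliciality to the alternating sum of the gcds [vol v S] needs
   n >= 2 and plucker v i j != 0 for i != j, i.e. pairwise linearly independent
   vectors.  Without this, the equivalence fails: a single nonzero vector gives
   the empty sum but no simplicial chambers; (1,0), (2,0), (0,1) gives the sum
   -(0 + 1 + 2) + 3 = 0 although the chambers are cones over rectangles; and
   (1,0), (0,1), (1,1), (1,0) is simplicial with sum -5 + 12 - 5 = 2. *)
Definition plucker (n : nat) (v : 'I_n -> 'cV[int]_2) : 'M[int]_n :=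
  \matrix_(i, j) \det (row_mx (v i) (v j) : 'M[int]_2).

(* gcdn has neutral element 0, so vol v S = 0 iff all the Plücker coordinates
   indexed by S vanish. *)
Definition vol (n : nat) (v : 'I_n -> 'cV[int]_2) (S : {set 'I_n}) : nat :=
  \big[gcdn/0%N]_(i in S) \big[gcdn/0%N]_(j in S) `|plucker v i j|%N.

(* Main.v *)
Require Import Defs.
From HB Require Import structures.
From mathcomp Require Import all_boot all_order all_algebra.
From mathcomp Require Import all_classical all_reals all_analysis.
From mathcomp Require Import ring lra zify.

Set Implicit Arguments.
Unset Strict Implicit.
Unset Printing Implicit Defensive.

Import Order.TTheory GRing.Theory Num.Theory.
Import numFieldNormedType.Exports.

Local Open Scope classical_set_scope.
Local Open Scope ring_scope.

(** Only the slice at height 1 matters: there the arrangement consists of the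
lines on which [v_i . x] is an integer, and a connected component of the
complement is the cone over a bounded polygon, a chamber, given by the integral
parts [a_i < v_i . x < a_i + 1] ([simplicial_cones]). So the arrangement is
simplicial iff all chambers are triangles. Everything is invariant under
translations by the integral lattice, hence there is a finite picture on the
torus. Call a point a vertex if at least two of the [v_i . x] are integers, and
let [m(x)] be the number of these integers.

The theorem is a count of corners of chambers, an elementary form of the Euler
relation on the torus. After changing signs there is a direction [u] with
[v_i . u > 0] for all [i]. Sweep the plane with a line parallel to [u]. Since no
wall is parallel to [u], every chamber has one leftmost and one rightmost corner;
the other corners are called side corners. At a vertex [x] exactly two chambers
have [x] as a side corner, namely those containing [x + t u] and [x - t u] for
small [t > 0] ([extremal_or_side], [extremal_not_side]). The
chambers with leftmost corner [x] are the [m(x) - 1] sectors between consecutive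
rays that leave [x] to the right ([below_extremal], [below_exists],
[below_inj]). Every chamber has at least one side corner and is a triangle iff
it has exactly one ([side_exists], [unique_side_simplicial],
[simplicial_unique_side]). Sending a side corner to the leftmost corner of the
same chamber is therefore a surjection on the torus, which is a bijection iff
the arrangement is simplicial ([unique_side_card]). Comparing cardinalities, the
arrangement is simplicial iff the sum over the vertices [x] of the torus of
[m(x) - 1] is twice their number, that is, iff the sum of [m(x) - 3] is zero.

It remains to see that the alternating sum of the statement is this sum. For
[#|S| >= 2] the points of the torus at which all [v_i . x] with [i] in [S] are
integers form the dual of the quotient of the integral plane by the lattice
generated by these [v_i], so their number is the index of that lattice, the gcd
of the 2 x 2 minors ([card_solutions], [vol_card]). Exchanging the summations,
the vertex [x] contributes the sum over [k >= 2] of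
[(-1)^(k+1) (2k - 3) binomial(m(x), k)]; the same sum over all [k >= 0] vanishes
because the weight is affine in [k], and the terms for [k = 0, 1] are [3] and
[- m(x)] ([weighted_subsets], [sum_vol]). *)

(** * Small matrices *)

Lemma sum2 (V : nmodType) (F : 'I_2 -> V) : \sum_i F i = F 0 + F 1.
Proof. by rewrite !big_ord_recl big_ord0 addr0; congr (_ + F _); apply: val_inj. Qed.

Lemma ord3_ind (P : 'I_3 -> Prop) : P 0 -> P 1 -> P ord_max -> forall i, P i.
Proof.
move=> h0 h1 h2 -[[|[|[|//]]] hi].
- by rewrite (_ : Ordinal hi = 0) //; apply: val_inj.
- by rewrite (_ : Ordinal hi = 1) //; apply: val_inj.
- by rewrite (_ : Ordinal hi = ord_max) //; apply: val_inj.
Qed.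

Lemma sum3 (V : nmodType) (F : 'I_3 -> V) : \sum_i F i = F 0 + F 1 + F ord_max.
Proof.
rewrite !big_ord_recl big_ord0 addr0 addrA; congr (_ + _ + F _); try exact: val_inj.
by congr F; apply: val_inj.
Qed.

Lemma col3P (T : Type) (y z : 'cV[T]_3) : y 0 0 = z 0 0 -> y 1 0 = z 1 0 ->
  y ord_max 0 = z ord_max 0 -> y = z.
Proof. by move=> h0 h1 h2; apply/colP; apply: ord3_ind. Qed.

Lemma det_mx22 (R : comNzRingType) (M : 'M[R]_2) : \det M = M 0 0 * M 1 1 - M 0 1 * M 1 0.
Proof.
have E : lift (0 : 'I_2) 0 = 1 by apply: val_inj.
rewrite (expand_det_row _ 0) !big_ord_recl big_ord0 addr0 /cofactor !det_mx11 !mxE E.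
rewrite /= !addn0 expr0 expr1 mul1r mulN1r mulrN.
congr (_ * _ - _ * M _ _); apply: val_inj => //.
Qed.
Lemma det_mx33 (R : comNzRingType) (M : 'M[R]_3) : \det M = 
  M 0 0 * (M 1 1 * M ord_max ord_max - M 1 ord_max * M ord_max 1) -
  M 0 1 * (M 1 0 * M ord_max ord_max - M 1 ord_max * M ord_max 0) +
  M 0 ord_max * (M 1 0 * M ord_max 1 - M 1 1 * M ord_max 0).
Proof.
have e (i : 'I_3) (j : 'I_2) (k : 'I_3) : bump i j = k -> lift i j = k by move=> h; apply: val_inj.
rewrite (expand_det_row _ 0) !big_ord_recl big_ord0 addr0 /cofactor !det_mx22 !mxE.
rewrite ?(e (lift 0 0) 0 0) ?(e (lift 0 0) 1 ord_max) //.
rewrite ?(e (lift 0 (lift 0 0)) 0 0) ?(e (lift 0 (lift 0 0)) 1 1) //.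
rewrite !(e 0 0 1) // !(e 0 1 ord_max) //=.
rewrite (_ : lift 0 (lift 0 0) = ord_max); last exact: val_inj.
rewrite /= !addn0 !addn1.
ring.
Qed.

(** * Counting solutions of linear congruences in two unknowns *)

Section Lattice.
Variable n : nat.
Implicit Types A : 'M[int]_(n, 2).

Definition minor A i j : int := A i 0 * A j 1 - A i 1 * A j 0.

(** The minors of [L *m A] are integral combinations of those of [A]: a minor is
bilinear in the pair of rows it uses. *)
Lemma dvdz_minor_mull (L : 'M[int]_n) A (e : int) :
  (forall i j, (e %| minor A i j)%Z) -> forall i j, (e %| minor (L *m A) i j)%Z.
Proof.
move=> H i j.
have -> : minor (L *m A) i j = \sum_k \sum_l L i k * L j l * minor A k l.
  rewrite /minor !mxE !big_distrlr /= -sumrB; apply: eq_bigr => k _.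
  by rewrite -sumrB; apply: eq_bigr => l _; ring.
by apply: rpred_sum => k _; apply: rpred_sum => l _; rewrite dvdz_mull.
Qed.

Lemma minor_mulr A (M : 'M[int]_2) i j : minor (A *m M) i j = minor A i j * \det M.
Proof. by rewrite det_mx22 /minor !mxE !sum2; ring. Qed.

Lemma dvdz_minor_unit (L : 'M[int]_n) A (M : 'M[int]_2) (e : int) :
  L \in unitmx -> M \in unitmx ->
  (forall i j, (e %| minor (L *m A *m M) i j)%Z) <-> (forall i j, (e %| minor A i j)%Z).
Proof.
move=> LU MU; split=> H i j; last first.
  by rewrite minor_mulr dvdz_mulr // dvdz_minor_mull.
rewrite -(mulKmx LU A); apply: dvdz_minor_mull => {}i {}j.
rewrite -(mulmxK MU (L *m A)) minor_mulr dvdz_mulr //.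
Qed.

End Lattice.

(** Unimodular changes of coordinates do not affect divisibility of all the
coordinates; this is used for the row operations of the Smith form. *)
Lemma dvdz_mulmx_unit n (L : 'M[int]_n) (x : 'cV[int]_n) (e : int) : L \in unitmx ->
  (forall i, (e %| (L *m x) i 0%R)%Z) <-> (forall i, (e %| x i 0%R)%Z).
Proof.
have mull (K : 'M[int]_n) (y : 'cV[int]_n) :
    (forall i, (e %| y i 0%R)%Z) -> forall i, (e %| (K *m y) i 0%R)%Z.
  by move=> H i; rewrite mxE; apply: rpred_sum => k _; rewrite dvdz_mull.
by move=> LU; split=> H; [rewrite -(mulKmx LU x)|]; apply: mull.
Qed.

Lemma card_multiples N e : (0 < N)%N -> (e %| N)%N ->
  #|[set y : 'I_N | (N %| e * y)%N]%SET| = e.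
Proof.
move=> N0 /dvdnP[k NE]; rewrite {}NE in N0 *.
have [k0 e0] : (0 < k /\ 0 < e)%N by apply/andP; rewrite -muln_gt0.
have lt (j : 'I_e) : (k * j < k * e)%N by rewrite ltn_pmul2l.
rewrite -[RHS](card_ord e) -(card_imset predT (f := fun j => Ordinal (lt j))); last first.
  by move=> i j [] /eqP; rewrite eqn_pmul2l // => /eqP; exact: val_inj.
have E (m : nat) : (k * e %| e * m)%N = (k %| m)%N by rewrite (mulnC e) dvdn_pmul2r.
apply: eq_card => y; rewrite inE E; apply/idP/imsetP => [/dvdnP[j yE]|[j _ ->]].
  have je : (j < e)%N by rewrite -(ltn_pmul2l k0) [(k * j)%N]mulnC -yE.
  by exists (Ordinal je) => //; apply: val_inj; rewrite /= yE mulnC.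
by rewrite /= dvdn_mulr.
Qed.

Definition mod_vec N (x : 'I_N * 'I_N) : 'cV[int]_2 :=
  \col_(i < 2) (if i == 0 then (x.1 : nat)%:Z else (x.2 : nat)%:Z).

(** By the Smith normal form, a unimodular change of the unknowns modulo [N] and
unimodular row operations reduce the system to [N %| s_0 * y_0] and
[N %| s_1 * y_1]. These operations preserve the common divisors of the minors,
so [d] is the absolute value of [s_0 * s_1]; both factors divide [N], and the
two congruences have [|s_0|] and [|s_1|] solutions. *)
Lemma card_solutions n (A : 'M[int]_(n, 2)) N d : (0 < N)%N -> (1 < n)%N -> (d %| N)%N ->
  (forall e : nat, (e %| d)%N <-> (forall i j, (e%:Z %| minor A i j)%Z)) ->
  #|[set x : 'I_N * 'I_N | [forall i, (N%:Z %| (A *m mod_vec x) i 0%R)%Z]]%SET| = d.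
Proof.
move=> N0 n1 dN dP.
have [L LU [M MU [s _ AE]]] := int_Smith_normal_form A.
set Dg := \matrix_(i, j) _ in AE.
pose i0 : 'I_n := Ordinal (ltnW n1); pose i1 : 'I_n := Ordinal n1.
have DgE (i : 'I_n) (j : 'I_2) : Dg i j = s`_i *+ (i == j :> nat) by rewrite mxE.
have dE : d = absz (s`_0 * s`_1).
  apply/eqP; rewrite eqn_dvd; apply/andP; split.
    have : (forall i j, (d%:Z %| minor A i j)%Z) by apply/dP.
    rewrite AE => /(dvdz_minor_unit _ _ LU MU)/(_ i0 i1).
    rewrite /minor !DgE /= !mulr0n mulr0 subr0 !mulr1n.
    by rewrite dvdzE.
  apply/dP; rewrite AE; apply/(dvdz_minor_unit _ _ LU MU) => i j.
  rewrite /minor !DgE /=.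
  case: i j => [[|[|i]] hi] [[|[|j]] hj] /=;
    rewrite ?(mulr0n, mulr1n, mulr0, mul0r, subr0, sub0r, subrr, dvdz0) ?rpredN //.
    by rewrite dvdzE absz_nat dvdnn.
  by rewrite dvdzE absz_nat mulrC dvdnn.
have [a aE] : exists a, a = absz s`_0 by exists (absz s`_0).
have [b bE] : exists b, b = absz s`_1 by exists (absz s`_1).
rewrite abszM -aE -bE in dE.
have aN : (a %| N)%N by apply: dvdn_trans dN; rewrite dE dvdn_mulr.
have bN : (b %| N)%N by apply: dvdn_trans dN; rewrite dE dvdn_mull.
pose red (t : int) : 'I_N := Ordinal (ltn_pmod `|(t %% N%:Z)%Z| N0).
have redP t : (N%:Z %| t - (red t : nat)%:Z)%Z.
  have Nz : N%:Z != 0 by rewrite eqz_nat -lt0n.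
  rewrite /red /= modn_small; last by rewrite -ltz_nat gez0_abs ?modz_ge0 // ltz_pmod.
  by rewrite gez0_abs ?modz_ge0 // -eqz_mod_dvd modz_mod.
pose f (x : 'I_N * 'I_N) := (red ((M *m mod_vec x) 0 0), red ((M *m mod_vec x) 1 0)).
have fP x i : (N%:Z %| (M *m mod_vec x - mod_vec (f x)) i 0%R)%Z.
  rewrite [X in (_ %| X)%Z]mxE [(- mod_vec _) i 0]mxE [mod_vec (f x) i 0]mxE.
  case: i => [[|[|//]] hi] /=.
    by rewrite (_ : Ordinal hi = 0) //; apply: val_inj.
  by rewrite (_ : Ordinal hi = 1) //; apply: val_inj.
have ord_congr (r t : 'I_N) : (N%:Z %| (r : nat)%:Z - (t : nat)%:Z)%Z -> r = t.
  rewrite -eqz_mod_dvd !modz_small ?ltz_nat ?ltn_ord // => /eqP[]; exact: val_inj.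
have f_inj : injective f.
  move=> x y fxy.
  have H i : (N%:Z %| (M *m (mod_vec x - mod_vec y)) i 0%R)%Z.
    have := fP x i; have := fP y i; rewrite -fxy => h1 h2; have := rpredB h2 h1.
    rewrite mulmxBr; congr (_ %| _)%Z; rewrite !mxE; ring.
  have {}H := (dvdz_mulmx_unit _ _ MU).1 H.
  have := H 0; have := H 1; rewrite !mxE /=.
  by case: x y {fxy H} => x1 x2 [y1 y2] /= /ord_congr-> /ord_congr->.
pose S := finset.setX [set y : 'I_N | (N %| a * y)%N]%SET [set y : 'I_N | (N %| b * y)%N]%SET.
rewrite dE -[a in RHS](card_multiples N0 aN) -[b in RHS](card_multiples N0 bN) -cardsX.
rewrite -[RHS](on_card_preimset (f := f)); last by apply: onW_bij; exact: injF_bij.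
apply: eq_card => x; rewrite !inE.
have congr_f (t : int) (i : 'I_2) :
    (N%:Z %| t * (M *m mod_vec x) i 0%R)%Z = (N%:Z %| t * mod_vec (f x) i 0%R)%Z.
  have -> : t * (M *m mod_vec x) i 0
      = t * (M *m mod_vec x - mod_vec (f x)) i 0 + t * mod_vec (f x) i 0.
    by rewrite [(M *m _ - _) i 0]mxE [(- mod_vec _) i 0]mxE; ring.
  by rewrite rpredDl // dvdz_mull.
have entry (i : 'I_n) : (Dg *m (M *m mod_vec x)) i 0
    = s`_0 *+ (i == 0%N :> nat) * (M *m mod_vec x) 0 0 + s`_1 *+ (i == 1%N :> nat) * (M *m mod_vec x) 1 0.
  by rewrite mxE sum2 !DgE; case: i => [[|[|i]] hi] //=; rewrite !mulr0n !mul0r.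
have -> : (N %| a * (f x).1)%N = (N%:Z %| s`_0 * (M *m mod_vec x) 0%R 0%R)%Z.
  by rewrite congr_f mxE dvdzE abszM /= aE.
have -> : (N %| b * (f x).2)%N = (N%:Z %| s`_1 * (M *m mod_vec x) 1%R 0%R)%Z.
  by rewrite congr_f mxE dvdzE abszM /= bE.
have -> : [forall i, (N%:Z %| (A *m mod_vec x) i 0%R)%Z]
    = [forall i, (N%:Z %| (Dg *m (M *m mod_vec x)) i 0%R)%Z].
  apply/forallP/forallP; rewrite AE -!mulmxA => H; exact/(dvdz_mulmx_unit _ _ LU).
apply/forallP/andP => [H|[H0 H1] i].
  have := H i0; have := H i1; rewrite !entry /= !mulr0n !mulr1n !mul0r add0r addr0.
  by move=> -> ->.
by rewrite entry rpredD //; [case: (i == 0%N :> nat)|case: (i == 1%N :> nat)];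
   rewrite ?mulr1n ?mulr0n ?mul0r ?dvdz0.
Qed.

(** * Alternating sums of binomial coefficients *)

(** The partial sums telescope because of Pascal's rule. *)
Lemma alternating_binomial m K :
  \sum_(0 <= k < K.+1) (-1) ^+ k * 'C(m.+1, k)%:Z = (-1) ^+ K * 'C(m, K)%:Z :> int.
Proof.
elim: K => [|K IH]; first by rewrite big_nat1 !bin0.
by rewrite big_nat_recr //= IH binS PoszD exprS; ring.
Qed.

(** Absorbing [k] into the binomial coefficient reduces this to
[alternating_binomial]. *)
Lemma alternating_binomial_weighted m K :
  \sum_(0 <= k < K.+2) (-1) ^+ k * k%:Z * 'C(m.+2, k)%:Z
  = - (m.+2%:Z * ((-1) ^+ K * 'C(m, K)%:Z)) :> int.
Proof.
rewrite big_nat_recl // mulr0 mul0r add0r -alternating_binomial mulr_sumr -sumrN.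
apply: eq_bigr => k _.
have -> : (-1) ^+ k.+1 * k.+1%:Z * 'C(m.+2, k.+1)%:Z = (-1) ^+ k.+1 * (k.+1 * 'C(m.+2, k.+1))%N%:Z :> int.
  by rewrite PoszM mulrA.
by rewrite -mul_bin_diag PoszM exprS; ring.
Qed.

(** The contribution of a vertex on [m] lines to the inclusion-exclusion sum. The
full sum from [k = 0] vanishes for [m >= 2], so only the terms [k = 0] and
[k = 1] remain, with the opposite sign. *)
Lemma weighted_subsets m n : (m <= n)%N -> (1 < n)%N ->
  \sum_(2 <= k < n.+1) (-1) ^+ k.+1 * (2 * k%:Z - 3) * 'C(m, k)%:Z
  = (if (1 < m)%N then m%:Z - 3 else 0) :> int.
Proof.
move=> mn n1; case: ifPn => [m1|]; last first.
  rewrite -leqNgt => m1; rewrite big_nat_cond big1 // => k /andP[/andP[k2 _] _].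
  by rewrite bin_small ?mulr0 // (leq_ltn_trans m1).
case: m m1 mn => [//|[//|m]] _ mn; case: n n1 mn => [//|[//|n]] _ mn.
have := alternating_binomial m.+1 n.+2.
have := alternating_binomial_weighted m n.+1.
rewrite bin_small // bin_small; last by lia.
rewrite !mulr0 oppr0 => W B.
have : \sum_(0 <= k < n.+3) (-1) ^+ k.+1 * (2 * k%:Z - 3) * 'C(m.+2, k)%:Z = 0 :> int.
  rewrite (eq_bigr (fun k => 3 * ((-1) ^+ k * 'C(m.+2, k)%:Z)
                             - 2 * ((-1) ^+ k * k%:Z * 'C(m.+2, k)%:Z))).
    by rewrite sumrB -!mulr_sumr W B; ring.
  by move=> k _; rewrite exprS; ring.
rewrite big_ltn // big_ltn // bin0 bin1 addrA addrC => /eqP; rewrite addr_eq0 => /eqP->.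
by rewrite expr1 sqrrN expr1n; ring.
Qed.

(** * Affine functions and convexity in the plane *)

Section Plane.
Variable R : realType.
Implicit Types x y e : R * R.

Definition along x (t : R) e : R * R := (x.1 + t * e.1, x.2 + t * e.2).
Definition disp x y : R * R := (y.1 - x.1, y.2 - x.2).

Definition convex_pred (K : R * R -> Prop) :=
  forall x y t, 0 <= t <= 1 -> K x -> K y -> K (along x t (disp x y)).

Lemma convex_between (K : R * R -> Prop) x e s t : convex_pred K -> 0 < s -> 0 < t ->
  K (along x s e) -> K (along x t (- e.1, - e.2)) -> K x.
Proof.
move=> cK s0 t0 Ks Kt.
have st0 : 0 < s + t by rewrite addr_gt0.
have st1 : 0 <= s / (s + t) <= 1.
  by rewrite ler_pdivrMr // mul1r lerDl (ltW t0) divr_ge0 // ltW.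
have := cK _ _ _ st1 Ks Kt.
rewrite /along /disp /=; case: x e {Ks Kt} => x1 x2 [e1 e2] /=.
have -> : x1 + s * e1 + s / (s + t) * (x1 + t * - e1 - (x1 + s * e1)) = x1.
  by field; rewrite lt0r_neq0.
have -> // : x2 + s * e2 + s / (s + t) * (x2 + t * - e2 - (x2 + s * e2)) = x2.
by field; rewrite lt0r_neq0.
Qed.

Lemma small_pos (A d : R) : 0 <= A -> (A = 0 -> 0 < d) ->
  exists2 eps, 0 < eps & forall t, 0 < t <= eps -> 0 < A + t * d.
Proof.
rewrite le_eqVlt => /orP[/eqP<- /(_ erefl) d0|A0 _].
  by exists 1 => // t /andP[t0 _]; rewrite add0r mulr_gt0.
have D0 : 0 < 2 * (`|d| + 1) by rewrite mulr_gt0 // ltr_wpDl.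
exists (A / (2 * (`|d| + 1))); first exact: divr_gt0.
move=> t /andP[t0]; rewrite ler_pdivlMr // => H.
have : - `|d| <= d by rewrite lerNl -normrN ler_norm.
have := normr_ge0 d; nra.
Qed.

Lemma uniform_small (I : finType) (P : I -> R -> Prop) :
  (forall j, exists2 eps, 0 < eps & forall t, 0 < t <= eps -> P j t) ->
  exists2 eps, 0 < eps & forall t, 0 < t <= eps -> forall j, P j t.
Proof.
move=> H.
have {H} [eps H] : exists eps : I -> R,
    forall j, 0 < eps j /\ forall t, 0 < t <= eps j -> P j t.
  have H' j : exists eps, 0 < eps /\ forall t, 0 < t <= eps -> P j t.
    by have [eps e0 He] := H j; exists eps.
  by have [eps He] := choice H'; exists eps.
exists (\big[Num.min/1]_j eps j).
  by elim/big_ind: _ => // [x y x0 y0|j _]; [rewrite lt_min x0|have [] := H j].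
move=> t /andP[t0 tle] j; apply: (H j).2; rewrite t0 (le_trans tle) //.
exact: bigmin_le_cond.
Qed.

Definition affine_fun (g : R * R -> R) :=
  forall x y t, g (along x t (disp x y)) = (1 - t) * g x + t * g y.

Lemma convex_half (g : R * R -> R) : affine_fun g -> convex_pred (fun y => 0 <= g y).
Proof.
move=> ag x y t /andP[t0 t1] gx gy; rewrite ag.
by rewrite addr_ge0 // mulr_ge0 // subr_ge0.
Qed.

Lemma convex_line (g : R * R -> R) : affine_fun g -> convex_pred (fun y => g y = 0).
Proof. by move=> ag x y t _ gx gy; rewrite ag gx gy !mulr0 addr0. Qed.

Definition det2 d e : R := d.1 * e.2 - d.2 * e.1.

Lemma affine_det2 d x : affine_fun (fun y => det2 d (disp x y)).
Proof. by move=> y z t; rewrite /det2 /disp /along /=; ring. Qed.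

Lemma det2_neq0 d x : d != (0, 0) -> exists y, det2 d (disp x y) != 0.
Proof.
case: x d => x1 x2 [d1 d2]; rewrite xpair_eqE negb_and => d0.
exists (x1 - d2, x2 + d1); rewrite /det2 /disp /=.
have -> : d1 * (x2 + d1 - x2) - d2 * (x1 - d2 - x1) = d1 ^+ 2 + d2 ^+ 2 by ring.
by rewrite paddr_eq0 ?sqr_ge0 // !sqrf_eq0 negb_and.
Qed.

End Plane.

(** * Strips, chambers and their corners *)

Section Strips.
Variables (R : realType) (n : nat) (p q : 'I_n -> int).
Implicit Types (x y e : R * R) (a : 'I_n -> int).

(** The scalar product with [v_i = (p i, q i)]. The lines on which it is an integer
are called the walls of family [i]. *)
Definition lin i x : R := (p i)%:~R * x.1 + (q i)%:~R * x.2.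
Definition cross i j : int := p i * q j - q i * p j.

Definition chamber a x := forall i, (a i)%:~R < lin i x < (a i)%:~R + 1.
Definition cchamber a x := forall i, (a i)%:~R <= lin i x <= (a i)%:~R + 1.
Definition vertex x := exists i j,
  [/\ i != j, lin i x \is a Num.int & lin j x \is a Num.int].
Definition corner a x := cchamber a x /\ vertex x.

(** The normal of [v_i] is the direction of the walls of family [i]. *)
Definition normal i : R * R := (- (q i)%:~R, (p i)%:~R).

Lemma lin_along i x t e : lin i (along x t e) = lin i x + t * lin i e.
Proof. by rewrite /lin /along /=; ring. Qed.

Lemma lin_disp i x y : lin i (disp x y) = lin i y - lin i x.
Proof. by rewrite /lin /disp /=; ring. Qed.

Lemma lin_opp i e : lin i (- e.1, - e.2) = - lin i e.
Proof. by rewrite /lin /=; ring. Qed.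

Lemma lin_normal i j : lin j (normal i) = (cross i j)%:~R.
Proof. by rewrite /lin /cross /= rmorphB !rmorphM /=; ring. Qed.

Lemma chamberW a x : chamber a x -> cchamber a x.
Proof. by move=> ax i; have /andP[/ltW-> /ltW->] := ax i. Qed.

Lemma cchamber_strict a x i : cchamber a x -> lin i x \isn't a Num.int ->
  (a i)%:~R < lin i x < (a i)%:~R + 1.
Proof.
move=> /(_ i)/andP[]; rewrite !le_eqVlt => /orP[/eqP<-|->].
  by rewrite intr_int.
case/orP=> [/eqP->|-> //].
by rewrite rpredD ?intr_int ?rpred1.
Qed.

Lemma chamber_nudge a x e : cchamber a x ->
    (forall j, lin j x = (a j)%:~R -> 0 < lin j e) ->
    (forall j, lin j x = (a j)%:~R + 1 -> lin j e < 0) ->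
  exists2 eps, 0 < eps & forall t, 0 < t <= eps -> chamber a (along x t e).
Proof.
move=> ax lo hi; apply: uniform_small => j.
have /andP[h1 h2] := ax j.
have [||eps e0 He] := @small_pos R (lin j x - (a j)%:~R) (lin j e).
- by rewrite subr_ge0.
- by move/subr0_eq/lo.
have [||eps' e'0 He'] := @small_pos R ((a j)%:~R + 1 - lin j x) (- lin j e).
- by rewrite subr_ge0.
- by move/subr0_eq/esym/hi; rewrite oppr_gt0.
exists (Num.min eps eps'); first by rewrite lt_min e0.
move=> t; rewrite le_min => /and3P[t0 t1 t2].
have := He t; have := He' t; rewrite t0 t1 t2 lin_along => /(_ isT) + /(_ isT).
lra.
Qed.

Lemma chamber_open a x e : chamber a x ->
  exists2 eps, 0 < eps & forall t, 0 < t <= eps -> chamber a (along x t e).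
Proof.
move=> ax; apply: chamber_nudge; first exact: chamberW.
  by move=> j h; have := ax j; rewrite h ltxx.
by move=> j h; have := ax j; rewrite h ltxx andbF.
Qed.

Hypothesis cross_neq0 : forall i j, i != j -> cross i j != 0.
Variables (k0 k1 : 'I_n).
Hypothesis k01 : k0 != k1.

Lemma lin_inj i j x y : i != j -> lin i x = lin i y -> lin j x = lin j y -> x = y.
Proof.
move=> ij hi hj; have c0 : (cross i j)%:~R != 0 :> R by rewrite intr_eq0 cross_neq0.
have e1 z : (cross i j)%:~R * z.1 = (q j)%:~R * lin i z - (q i)%:~R * lin j z.
  by rewrite /lin /cross rmorphB !rmorphM /=; ring.
have e2 z : (cross i j)%:~R * z.2 = (p i)%:~R * lin j z - (p j)%:~R * lin i z.
  by rewrite /lin /cross rmorphB !rmorphM /=; ring.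
rewrite [x]surjective_pairing [y]surjective_pairing.
by congr pair; apply: (mulfI c0); rewrite ?e1 ?e2 hi hj.
Qed.

Lemma lin_neq0 e : e != (0, 0) -> exists i, lin i e != 0.
Proof.
move=> e0; have [h0|h0] := eqVneq (lin k0 e) 0; last by exists k0.
have [h1|h1] := eqVneq (lin k1 e) 0; last by exists k1.
case/eqP: e0; apply: (lin_inj k01); rewrite ?h0 ?h1 /lin /=; ring.
Qed.

(** Chambers are bounded, since two of the [v_i] are independent: moving from a
point of a closed chamber along the walls through it, one stays on these walls
and meets a new one. The first of the finitely many meeting times is the one
wanted. *)
Lemma hit_wall a x e : cchamber a x -> e != (0, 0) ->
    (forall i, lin i x \is a Num.int -> lin i e = 0) ->
  exists2 t, 0 < t & cchamber a (along x t e) /\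
    exists2 i, lin i x \isn't a Num.int & lin i (along x t e) \is a Num.int.
Proof.
move=> ax /lin_neq0[i0 hi0] tight.
(* The time at which the moving point reaches the next wall of family [i]. *)
pose time i := (if 0 < lin i e then (a i)%:~R + 1 - lin i x
                else (a i)%:~R - lin i x) / lin i e.
have time0 i : lin i e != 0 -> 0 < time i.
  move=> ne; have nt : lin i x \isn't a Num.int.
    by apply/negP=> /tight h; rewrite h eqxx in ne.
  have /andP[h1 h2] := cchamber_strict ax nt.
  rewrite /time; case: ifPn => [h|]; first by rewrite divr_gt0 // subr_gt0.
  rewrite -leNgt le_eqVlt (negbTE ne) /= => h.
  by rewrite -mulrNN -invrN divr_gt0 ?oppr_gt0 ?subr_lt0.
case: (@arg_minP _ R _ i0 (fun i => lin i e != 0) time) => // i ne imin.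
exists (time i); first exact: time0.
split; last first.
  exists i; first by apply/negP => /tight h; rewrite h eqxx in ne.
  rewrite lin_along /time divfK //; case: ifP => _.
    by rewrite subrKC rpredD ?intr_int ?rpred1.
  by rewrite subrKC intr_int.
move=> j; rewrite lin_along.
have [->|nej] := eqVneq (lin j e) 0; first by rewrite mulr0 addr0.
have h0 := time0 _ ne; have := imin _ nej; have /andP[h1 h2] := ax j.
set T := time i in h0 *.
rewrite {1}/time; case: ifPn => [h|].
  rewrite ler_pdivlMr // => h3.
  have : 0 <= T * lin j e by rewrite mulr_ge0 // ltW.
  lra.
rewrite -leNgt le_eqVlt (negbTE nej) /= => h.
rewrite ler_ndivlMr // => h3.
have : T * lin j e <= 0 by rewrite nmulr_lle0 // ltW.
lra.
Qed.

Lemma normal_neq0 i : normal i != (0, 0).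
Proof.
apply/eqP => h; have [j ij] : exists j, i != j.
  by have [->|] := eqVneq i k0; [exists k1|exists k0].
have := cross_neq0 ij; rewrite -(intr_eq0 R) -lin_normal h.
by rewrite /lin /= !mulr0 addr0 eqxx.
Qed.

(** A closed chamber is the convex hull of its corners. A point on exactly one
wall, or on none, is moved in two opposite directions until it meets a new wall;
it lies between the two points found, which are on more walls. *)
Lemma corners_hull a (K : R * R -> Prop) : convex_pred K ->
  (forall x, corner a x -> K x) -> forall x, cchamber a x -> K x.
Proof.
move=> cK hK.
(* Points on at least one wall. *)
have step1 x i : cchamber a x -> lin i x \is a Num.int -> K x.
  move=> ax ix.
  have [[j /andP[ij jx]]|nj] := pselect (exists j, (i != j) && (lin j x \is a Num.int)).
    by apply: hK; split=> //; exists i, j.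
  have go e : e != (0, 0) -> lin i e = 0 -> exists2 t, 0 < t & K (along x t e).
    move=> e0 ie.
    have tight j : lin j x \is a Num.int -> lin j e = 0.
      have [<-//|ij jx] := eqVneq i j.
      by case: nj; exists j; rewrite ij.
    have [t t0 [at_ [j jn jt]]] := hit_wall ax e0 tight.
    exists t => //; apply: hK; split=> //; exists i, j; split=> //.
      by apply/eqP => ij; rewrite -ij ix in jn.
    by rewrite lin_along ie mulr0 addr0.
  have in0 : lin i (normal i) = 0 by rewrite lin_normal /cross mulrC subrr.
  have [s s0 Ks] := go _ (normal_neq0 i) in0.
  have [||t t0 Kt] := go (- (normal i).1, - (normal i).2).
  - have := normal_neq0 i; case: (normal i) => e1 e2; apply: contra => /eqP[/eqP + /eqP].
    by rewrite !oppr_eq0 => /eqP-> /eqP->.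
  - by rewrite lin_opp in0 oppr0.
  exact: (convex_between cK s0 t0 Ks Kt).
move=> x ax.
have [[i ix]|ni] := pselect (exists i, lin i x \is a Num.int); first exact: step1 ix.
have go e : e != (0, 0) -> exists2 t, 0 < t & K (along x t e).
  move=> e0; have [|t t0 [at_ [j _ jt]]] := hit_wall ax e0.
    by move=> i ix; case: ni; exists i.
  by exists t => //; apply: step1 at_ jt.
have [|s s0 Ks] := go (1, 0); first by rewrite xpair_eqE oner_eq0.
have [|t t0 Kt] := go (- (1 : R, 0 : R).1, - (1 : R, 0 : R).2).
  by rewrite xpair_eqE oppr_eq0 oner_eq0.
exact: (convex_between cK s0 t0 Ks Kt).
Qed.

(** The corners of a nonempty chamber affinely span the plane. *)
Lemma affine_zero a b (g : R * R -> R) : affine_fun g -> chamber a b ->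
  (forall x, corner a x -> g x = 0) -> forall y, g y = 0.
Proof.
move=> ag ab gx y.
have g0 := corners_hull (convex_line ag) gx.
have [t t0 /(_ t)] := chamber_open (disp b y) ab.
rewrite t0 lexx => /(_ isT)/chamberW/g0.
rewrite ag (g0 _ (chamberW ab)) mulr0 add0r => /eqP.
by rewrite mulf_eq0 (gt_eqF t0) => /eqP.
Qed.

(** An affine function that is nonnegative on an open set and vanishes at one of its
points is zero. *)
Lemma affine_pos a b (g : R * R -> R) y : affine_fun g -> chamber a b ->
  (forall x, corner a x -> 0 <= g x) -> g y != 0 -> 0 < g b.
Proof.
move=> ag ab gx gy.
have g0 := corners_hull (convex_half ag) gx.
rewrite lt0r (g0 _ (chamberW ab)) andbT; apply/eqP => gb.
have [s s0 /(_ s)] := chamber_open (disp b y) ab.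
rewrite s0 lexx => /(_ isT)/chamberW/g0; rewrite ag gb mulr0 add0r pmulr_rge0 // => gy0.
have [t t0 /(_ t)] := chamber_open (- (disp b y).1, - (disp b y).2) ab.
rewrite t0 lexx => /(_ isT)/chamberW/g0.
have -> : along b t (- (disp b y).1, - (disp b y).2) = along b (- t) (disp b y).
  by rewrite /along /= !mulrN !mulNr.
rewrite ag gb mulr0 add0r mulNr oppr_ge0 pmulr_rle0 // => gy1.
by case/eqP: gy; apply: le_anti; rewrite gy0 gy1.
Qed.

(** * Chambers around a point *)

(** The label of a chamber with [x] in its closure: [s] tells, for each wall
through [x], on which side of it the chamber lies. For the other families the
two cases agree. *)
Definition label (s : 'I_n -> bool) x i : int :=
  if s i then Num.floor (lin i x) else Num.ceil (lin i x) - 1.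

(** The chambers met when leaving [x] in the direction [u] (for [true]) and in the
direction [- u] (for [false]), since [u] will be chosen positive on all the
[v_i]. *)
Definition side (b : bool) x := label (fun=> b) x.

(** The walls are graphs over the sweep axis, and a positive [cross i j] means that
those of family [i] are steeper. Hence, for [x] on a wall of family [i], this is
the chamber just below the ray that leaves [x] to the right along that wall: it
lies above the less steep walls through [x] and below the other ones. *)
Definition below i x := label (fun j => 0 < cross i j) x.

Lemma label_cchamber s x : cchamber (label s x) x.
Proof.
move=> i; rewrite /label; case: (s i).
  have /andP[-> h] := floor_itv (lin i x); rewrite -intrD1 in h *; exact: ltW.
by have /andP[/ltW-> h] := ceil_itv (lin i x); rewrite -intrD1 subrK.
Qed.

Lemma label_nudge (s : 'I_n -> bool) x e :
    (forall j, s j -> 0 < lin j e) -> (forall j, ~~ s j -> lin j e < 0) ->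
  exists2 eps, 0 < eps & forall t, 0 < t <= eps -> chamber (label s x) (along x t e).
Proof.
move=> lo hi; apply: chamber_nudge => [|j|j]; first exact: label_cchamber.
  rewrite /label; case: ifP => [/lo //|_ h].
  by have /andP[] := ceil_itv (lin j x); rewrite {2}h ltxx.
rewrite /label; case: ifPn => [_ h|/hi //].
by have /andP[_] := floor_itv (lin j x); rewrite {1}h intrD1 ltxx.
Qed.

Lemma floor_chamber a x i : cchamber a x -> lin i x != (a i)%:~R + 1 ->
  Num.floor (lin i x) = a i.
Proof.
move=> /(_ i)/andP[h1 h2] ne; apply: floor_def.
by rewrite h1 intrD1 lt_neqAle ne.
Qed.

Lemma ceil_chamber a x i : cchamber a x -> lin i x != (a i)%:~R ->
  Num.ceil (lin i x) - 1 = a i.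
Proof.
move=> /(_ i)/andP[h1 h2] ne; apply/eqP; rewrite subr_eq; apply/eqP/ceil_def.
by rewrite addrK intrD1 h2 lt_neqAle eq_sym ne h1.
Qed.

(** * Sweeping a chamber *)

Variable u : R * R.
Hypothesis u_pos : forall i, 0 < lin i u.

(** The position of the sweep line, which is parallel to [u], when it passes
through [x]. *)
Definition sweep x := det2 u x.

Lemma sweep_disp x y : sweep (disp x y) = sweep y - sweep x.
Proof. by rewrite /sweep /det2 /disp /=; ring. Qed.

Lemma u_neq0 : u != (0, 0).
Proof.
by apply/eqP => h; have := u_pos k0; rewrite h /lin /= !mulr0 addr0 ltxx.
Qed.

(** The Binet-Cauchy identity in the plane. It turns the signs of two linear forms
on a tangent vector [e] into the sign of its sweep component. *)
Lemma cross_sweep i j e :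
  lin j u * lin i e - lin i u * lin j e = - (cross i j)%:~R * sweep e.
Proof. by rewrite /lin /sweep /det2 /cross rmorphB !rmorphM /=; ring. Qed.

(** If a chamber lies below a wall through [x] and above another one, it lies
entirely to one side of the sweep line through [x], and the sign of the cross
product decides on which one. *)
Lemma tangent_sweep a x i j y : lin i x = (a i)%:~R + 1 -> lin j x = (a j)%:~R ->
  cchamber a y -> 0 <= (cross i j)%:~R * (sweep y - sweep x).
Proof.
move=> ix jx ay; have := cross_sweep i j (disp x y).
rewrite sweep_disp !lin_disp ix jx.
have /andP[_ hi] := ay i; have /andP[hj _] := ay j.
rewrite -subr_le0 in hi; rewrite -subr_ge0 in hj.
have := u_pos i; have := u_pos j => uj ui E.
rewrite -oppr_le0 -mulNr -E subr_le0.
by rewrite (@le_trans _ _ 0) // ?(pmulr_rle0 _ uj) // mulr_ge0 // ltW.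
Qed.

(** The leftmost corners for [s = 1] and the rightmost ones for [s = -1]; the sign as
a parameter treats both at once. *)
Definition extremal (s : R) a x :=
  corner a x /\ forall y, cchamber a y -> s * sweep x <= s * sweep y.

Lemma sweep_nonconst a b r : chamber a b -> exists2 y, cchamber a y & sweep y != r.
Proof.
move=> ab; apply: contrapT => H.
have sr y : cchamber a y -> sweep y = r.
  by move=> ay; apply/eqP/negPn/negP => ne; apply: H; exists y.
have [y /eqP] := det2_neq0 b u_neq0; apply.
apply: (affine_zero (@affine_det2 _ u b) ab) => x [ax _].
by rewrite -/(sweep _) sweep_disp (sr _ ax) (sr _ (chamberW ab)) subrr.
Qed.

(** There are finitely many candidates for a corner of a given chamber, the
intersections of two of its bounding lines. The best one among those that are
corners is extremal on the whole closed chamber, since the chamber is the convex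
hull of its corners. *)
Lemma extremal_exists s a b : chamber a b -> exists x, extremal s a x.
Proof.
move=> ab.
pose wall i (c : bool) : R := (a i)%:~R + c%:R.
pose meet (t : 'I_n * 'I_n * bool * bool) : R * R :=
  let: (i, j, c, d) := t in
  (((q j)%:~R * wall i c - (q i)%:~R * wall j d) / (cross i j)%:~R,
   ((p i)%:~R * wall j d - (p j)%:~R * wall i c) / (cross i j)%:~R).
have on_wall x i : cchamber a x -> lin i x \is a Num.int ->
    exists c, lin i x = wall i c.
  move=> ax ix; have /andP[h1 h2] := ax i.
  have [h|/(floor_chamber ax) h] := eqVneq (lin i x) ((a i)%:~R + 1); first by exists true.
  by exists false; rewrite /wall addr0 -h floorK.
have corner_meet x : corner a x -> exists t, x = meet t.
  move=> [ax [i [j [ij ix jx]]]].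
  have [c hc] := on_wall _ _ ax ix; have [d hd] := on_wall _ _ ax jx.
  exists (i, j, c, d); rewrite /= -hc -hd.
  have c0 : (cross i j)%:~R != 0 :> R by rewrite intr_eq0 cross_neq0.
  have e1 : (q j)%:~R * lin i x - (q i)%:~R * lin j x = x.1 * (cross i j)%:~R.
    by rewrite /lin /cross rmorphB !rmorphM /=; ring.
  have e2 : (p i)%:~R * lin j x - (p j)%:~R * lin i x = x.2 * (cross i j)%:~R.
    by rewrite /lin /cross rmorphB !rmorphM /=; ring.
  by rewrite e1 e2 !mulfK // -surjective_pairing.
have [x0 cx0] : exists x, corner a x.
  apply: contrapT => no.
  apply: (@corners_hull a (fun=> False) _ _ b (chamberW ab)); first by [].
  by move=> x cx; apply: no; exists x.
have [t0 xt0] := corner_meet _ cx0; rewrite {}xt0 in cx0.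
case: (@arg_minP _ R _ t0 (fun t => `[< corner a (meet t) >]) (fun t => s * sweep (meet t))).
  exact/asboolP.
move=> t /asboolP ct tmin; exists (meet t); split=> // y ay.
rewrite -subr_ge0; move: y ay; apply: corners_hull => [|x cx].
  apply: convex_half => y z r; rewrite /sweep /det2 /along /disp /=; ring.
have [t' xt'] := corner_meet _ cx; rewrite xt' subr_ge0 tmin //.
by apply/asboolP; rewrite -xt'.
Qed.

(** If no wall through [x] bounds the chamber from above, the chamber contains
[x + t u] for small [t], and likewise below. *)
Lemma not_side_walls a x : corner a x -> (forall b, side b x <> a) ->
  exists i j, lin i x = (a i)%:~R + 1 /\ lin j x = (a j)%:~R.
Proof.
move=> [ax _] ns.
have [i hi] : exists i, lin i x = (a i)%:~R + 1.
  apply: contrapT => H; apply: (ns true); apply/funext => i; apply: floor_chamber ax _.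
  by apply/eqP => h; apply: H; exists i.
have [j hj] : exists j, lin j x = (a j)%:~R.
  apply: contrapT => H; apply: (ns false); apply/funext => j; apply: ceil_chamber ax _.
  by apply/eqP => h; apply: H; exists j.
by exists i, j.
Qed.

Lemma opposite_walls_neq a x i j : lin i x = (a i)%:~R + 1 -> lin j x = (a j)%:~R -> i != j.
Proof. by move=> + jx; apply: contra_eqN => /eqP->; rewrite jx lt_eqF // ltrDl. Qed.

Lemma extremal_or_side a x : corner a x ->
  [\/ extremal 1 a x, extremal (-1) a x | exists b, side b x = a].
Proof.
move=> cx; have [|ns] := pselect (exists b, side b x = a); first by constructor 3.
have [b e|i [j [ix jx]]] := not_side_walls cx; first by apply: ns; exists b.
have T := tangent_sweep ix jx.
have := cross_neq0 (opposite_walls_neq ix jx); rewrite neq_lt => /orP[c0|c0].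
  constructor 2; split=> // y /T; rewrite nmulr_rge0 ?ltrz0 // subr_le0.
  by rewrite !mulN1r lerN2.
constructor 1; split=> // y /T; rewrite pmulr_rge0 ?ltr0z // subr_ge0.
by rewrite !mul1r.
Qed.

Lemma side_chamber b x : exists2 y, chamber (side b x) y & sweep y = sweep x.
Proof.
pose e : R * R := if b then u else (- u.1, - u.2).
have [||t t0 /(_ t)] := @label_nudge (fun=> b) x e.
- by rewrite /e => j ->.
- by rewrite /e => j /negbTE->; rewrite lin_opp oppr_lt0.
rewrite t0 lexx => /(_ isT) h; exists (along x t e) => //.
by rewrite /sweep /along /det2 /e {e h}; case: b => /=; ring.
Qed.

(** Near a side corner the chamber contains a whole segment parallel to [u], so it
extends to both sides of the sweep line. *)
Lemma extremal_not_side s a x b : s != 0 -> extremal s a x -> side b x <> a.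
Proof.
move=> s0 [_ H] E; have [y ay yx] := side_chamber b x; rewrite E in ay.
have [t t0 /(_ t)] := chamber_open (s * u.2, - (s * u.1)) ay.
rewrite t0 lexx => /(_ isT)/chamberW/H.
rewrite -yx /sweep /along /det2 /= -subr_ge0.
rewrite [X in 0 <= X](_ : _ = - (t * (s ^+ 2 * (u.1 ^+ 2 + u.2 ^+ 2)))); last by ring.
rewrite oppr_ge0 leNgt mulr_gt0 // mulr_gt0 //; first by rewrite exprn_even_gt0.
have := u_neq0; rewrite [u]surjective_pairing xpair_eqE negb_and /= => un.
by rewrite lt0r addr_ge0 ?sqr_ge0 // paddr_eq0 ?sqr_ge0 // !sqrf_eq0 negb_and un.
Qed.

(** Two extremal corners would differ by a multiple of [u], but the chamber lies
above a wall through the first one and below another one. *)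
Lemma extremal_uniq s a x y : s != 0 -> extremal s a x -> extremal s a y -> x = y.
Proof.
move=> s0 ex ey.
have sxy : sweep x = sweep y.
  apply: (mulfI s0); apply: le_anti; rewrite ex.2 ?ey.2 //; first by case: ex => -[].
  by case: ey => -[].
have [b|i [j [ix jx]]] := not_side_walls ex.1; first exact: (extremal_not_side s0).
have := cross_sweep i j (disp x y).
rewrite sweep_disp sxy subrr mulr0 !lin_disp ix jx => /eqP; rewrite subr_eq0 => /eqP E.
have [[ay _] _] := ey.
have /andP[_ hi] := ay i; have /andP[hj _] := ay j.
rewrite -subr_le0 in hi; rewrite -subr_ge0 in hj.
have h0 : lin j u * (lin i y - ((a i)%:~R + 1)) = 0.
  apply: le_anti; rewrite (pmulr_rle0 _ (u_pos j)) hi /= E.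
  by rewrite (pmulr_rge0 _ (u_pos i)).
have h1 : lin i u * (lin j y - (a j)%:~R) = 0 by rewrite -E.
apply: (lin_inj (opposite_walls_neq ix jx)); rewrite ?ix ?jx; apply/eqP; rewrite eq_sym -subr_eq0.
  by move/eqP: h0; rewrite mulf_eq0 gt_eqF.
by move/eqP: h1; rewrite mulf_eq0 gt_eqF.
Qed.

(** Otherwise the chamber would be the convex hull of its leftmost and its
rightmost corner, which is contained in a line. *)
Lemma side_exists a y : chamber a y -> exists b x, vertex x /\ side b x = a.
Proof.
move=> ay; apply: contrapT => H.
have [l el] := extremal_exists 1 ay; have [r er] := extremal_exists (-1) ay.
have [d d0 dr] : exists2 d, d != (0, 0) & det2 d (disp l r) = 0.
  have [h|h] := eqVneq (disp l r) (0, 0).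
    by exists u; [exact: u_neq0|rewrite h /det2 !mulr0 subrr].
  by exists (disp l r); rewrite // /det2 mulrC subrr.
have [z /eqP] := det2_neq0 l d0; apply.
apply: (affine_zero (@affine_det2 _ d l) ay) => x cx.
have [ex|ex|[b xb]] := extremal_or_side cx.
- by rewrite (extremal_uniq _ el ex) ?oner_eq0 // /disp /det2 /=; ring.
- by rewrite -(extremal_uniq _ er ex) // oppr_eq0 oner_eq0.
- by case: H; exists b, x; split=> //; case: cx.
Qed.

Lemma side_corner b x : vertex x -> corner (side b x) x.
Proof. by move=> vx; split=> //; exact: label_cchamber. Qed.

(** The chamber lies below the wall of family [i] and above that of family [j],
which meet at [x] and bound a cone opening to the right. *)
Lemma below_extremal i j x : lin i x \is a Num.int -> lin j x \is a Num.int ->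
  0 < cross i j -> extremal 1 (below i x) x.
Proof.
move=> ix jx c0.
have ij : i != j.
  by apply: contraTN c0 => /eqP->; rewrite /cross mulrC subrr ltxx.
split; first by split; [exact: label_cchamber|exists i, j].
move=> y ay; rewrite !mul1r -subr_ge0.
have := @tangent_sweep (below i x) x i j y _ _ ay; rewrite pmulr_rge0 ?ltr0z //; apply.
  by rewrite /below /label /cross mulrC subrr ltxx -intrD1 subrK ceilK.
by rewrite /below /label c0 floorK.
Qed.

(** Follow the ray along the wall of family [i], tilted slightly downwards. A tilt
by [u / S] is small enough because the nonzero cross products are at least 1 in
absolute value. *)
Lemma below_chamber i x : exists y, chamber (below i x) y.
Proof.
pose S := 1 + \sum_k lin k u.
have S0 : 0 < S by rewrite ltr_wpDr // sumr_ge0 // => k _; exact: ltW.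
have small j : S^-1 * lin j u < 1.
  rewrite mulrC ltr_pdivrMr // mul1r /S (bigD1 j) //= addrCA ltrDl ltr_wpDr //.
  by rewrite sumr_ge0 // => k _; exact: ltW.
have pos j : 0 < S^-1 * lin j u by rewrite mulr_gt0 // invr_gt0.
have [j|j|t t0 /(_ t)] :=
    @label_nudge (fun j => 0 < cross i j) x (along (normal i) (- S^-1) u).
- move=> c0; rewrite lin_along lin_normal mulNr subr_gt0.
  by apply: (lt_le_trans (small j)); rewrite ler1z; lia.
- rewrite -leNgt => c0; rewrite lin_along lin_normal mulNr subr_lt0.
  by apply: le_lt_trans (pos j); rewrite lerz0.
by rewrite t0 lexx => /(_ isT) h; eexists; exact: h.
Qed.

Lemma below_inj x i j : lin i x \is a Num.int -> lin j x \is a Num.int ->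
  below i x = below j x -> i = j.
Proof.
move=> ix jx E; apply/eqP/negPn/negP => ij.
have nfc (r : R) : r \is a Num.int -> Num.floor r = Num.ceil r - 1 :> int -> False.
  by move=> ir; rewrite ceil_floor ir; move: (Num.floor r) => m /=; lia.
have anti : cross j i = - cross i j by rewrite /cross; ring.
have cii k : cross k k = 0 by rewrite /cross mulrC subrr.
have := cross_neq0 ij; rewrite neq_lt => /orP[c0|c0].
  have := congr1 (fun f => f i) E; rewrite /below /label anti cii ltxx oppr_gt0 c0.
  by move/esym/nfc; apply.
have := congr1 (fun f => f j) E; rewrite /below /label cii ltxx c0.
by move/nfc; apply.
Qed.

(** The rate at which the walls of family [i] descend along the sweep axis. It orders
the families as the cross product does, so that finite sets of families have a
least steep member. *)
Definition descent i : R := lin i (- u.2, u.1) / lin i u.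

Lemma descent_lt i j : (descent i < descent j) = (0 < cross i j).
Proof.
rewrite /descent ltr_pdivrMr // mulrAC ltr_pdivlMr // -subr_gt0.
rewrite [X in 0 < X](_ : _ = (cross i j)%:~R * (u.1 ^+ 2 + u.2 ^+ 2)); last first.
  by rewrite /lin /cross rmorphB !rmorphM /=; ring.
rewrite pmulr_lgt0 ?ltr0z //.
have := u_neq0; rewrite [u]surjective_pairing xpair_eqE negb_and /= => un.
by rewrite lt0r addr_ge0 ?sqr_ge0 // paddr_eq0 ?sqr_ge0 // !sqrf_eq0 negb_and un.
Qed.

(** Take the leftmost corner and, among the walls through it that bound the
chamber from above, the least steep one. *)
Lemma below_exists a y : chamber a y -> exists x i j,
  [/\ lin i x \is a Num.int, lin j x \is a Num.int, 0 < cross i j & below i x = a].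
Proof.
move=> ay; have [x ex] := extremal_exists 1 ay.
have [b|i0 [j [ix0 jx]]] := not_side_walls ex.1.
  by apply: extremal_not_side ex; rewrite oner_eq0.
case: (@arg_maxP _ R _ i0 (fun i => lin i x == (a i)%:~R + 1) descent).
  exact/eqP.
move=> i /eqP ix imax.
have pos k : lin k x = (a k)%:~R -> 0 < cross i k.
  move=> kx; have := cross_neq0 (opposite_walls_neq ix kx); rewrite neq_lt => /orP[c0|//].
  have [z az /eqP[]] := sweep_nonconst (sweep x) ay.
  apply: le_anti; have := ex.2 _ az; rewrite !mul1r => ->; rewrite andbT.
  by have := tangent_sweep ix kx az; rewrite nmulr_rge0 ?ltrz0 // subr_le0.
exists x, i, j; split; [| |exact: pos|].
- by rewrite ix -intrD1 intr_int.
- by rewrite jx intr_int.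
apply/funext => k; rewrite /below /label; case: ifPn => c0.
  apply: floor_chamber ex.1.1 _; apply/eqP => /eqP/imax h.
  by have : descent k <= descent i := h; rewrite leNgt descent_lt c0.
by apply: ceil_chamber ex.1.1 _; apply/eqP => /pos; rewrite (negbTE c0).
Qed.

(** * Chambers as cones over triangles *)

(** The inclusion of the plane as the slice at height 1. *)
Definition homog x : 'cV[R]_3 := \col_(i < 3) nth 0 [:: x.1; x.2; 1] i.
Definition slice (y : 'cV[R]_3) : R * R :=
  (y 0 0 / y ord_max 0, y 1 0 / y ord_max 0).
Definition cone a : set 'cV[R]_3 :=
  [set y : 'cV[R]_3 | 0 < y ord_max 0 /\ chamber a (slice y)].

Lemma homog0 x : homog x 0 0 = x.1. Proof. by rewrite mxE. Qed.
Lemma homog1 x : homog x 1 0 = x.2. Proof. by rewrite mxE. Qed.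
Lemma homog2 x : homog x ord_max 0 = 1. Proof. by rewrite mxE. Qed.

Lemma homogK x : slice (homog x) = x.
Proof. by rewrite /slice homog0 homog1 homog2 !divr1 -surjective_pairing. Qed.

Lemma sliceK (y : 'cV[R]_3) : y ord_max 0 != 0 -> y = y ord_max 0 *: homog (slice y).
Proof.
by move=> y0; apply: col3P; rewrite mxE ?homog0 ?homog1 ?homog2 ?mulr1 //= mulrC divfK.
Qed.

Lemma homog_along x y t : homog (along x t (disp x y)) = homog x + t *: (homog y - homog x).
Proof. by apply: col3P; rewrite !mxE /=; ring. Qed.

Lemma cone_homog a x : cone a (homog x) <-> chamber a x.
Proof. by rewrite /cone /= homog2 homogK; split=> [[]|]. Qed.

Definition lin3 i (y : 'cV[R]_3) : R := (p i)%:~R * y 0 0 + (q i)%:~R * y 1 0.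

Lemma coneP a (y : 'cV[R]_3) : cone a y <-> 0 < y ord_max 0 /\
  forall i, (a i)%:~R * y ord_max 0 < lin3 i y < ((a i)%:~R + 1) * y ord_max 0.
Proof.
have E i : lin i (slice y) = lin3 i y / y ord_max 0.
  by rewrite /lin /lin3 /slice /= mulrDl !mulrA.
by split=> -[y0 H]; split=> // i; have := H i; rewrite E ltr_pdivlMr // ltr_pdivrMr.
Qed.

Lemma chamber_segment a x b t : cchamber a x -> chamber a b -> 0 < t <= 1 ->
  chamber a (along x t (disp x b)).
Proof.
move=> ax ab /andP[t0 t1] i; rewrite lin_along lin_disp.
by have /andP[h1 h2] := ax i; have /andP[h3 h4] := ab i; apply/andP; split; nra.
Qed.

Section SimplicialCone.
Variables (a : 'I_n -> int) (b : R * R) (w : 'M[R]_3).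
Hypothesis ab : chamber a b.
Hypothesis wU : w \in unitmx.
Hypothesis cone_w : cone a = [set y : 'cV[R]_3 | exists2 c : 'I_3 -> R,
                   forall i : 'I_3, 0 < c i & y = \sum_(i < 3) c i *: col i w].

Let coef (i : 'I_3) (y : 'cV[R]_3) : R := (invmx w *m y) i 0.

Let coefD (i : 'I_3) (y z : 'cV[R]_3) t : coef i (y + t *: z) = coef i y + t * coef i z.
Proof. by rewrite /coef mulmxDr -scalemxAr !mxE. Qed.

Let coef_sum (y : 'cV[R]_3) : y = \sum_i coef i y *: col i w.
Proof.
rewrite -{1}[y](mulKVmx wU); apply/matrixP => j j0; rewrite ord1 mxE summxE.
by apply: eq_bigr => k _; rewrite /coef [in RHS]mxE [col k w j 0]mxE mulrC.
Qed.

Let coef_col (i j : 'I_3) : coef i (col j w) = (i == j)%:R.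
Proof. by rewrite /coef colE mulKmx // mxE eqxx andbT. Qed.

Let coneE (y : 'cV[R]_3) : cone a y <-> forall i : 'I_3, 0 < coef i y.
Proof.
rewrite cone_w; split=> /= [[c c0 ->] i|H]; last by exists (coef^~ y).
have -> : coef i (\sum_(i < 3) c i *: col i w) = c i; last exact: c0.
rewrite /coef mulmx_sumr summxE (bigD1 i) //= big1 => [|j ji].
  by rewrite addr0 -scalemxAr mxE -/(coef i _) coef_col eqxx mulr1.
by rewrite -scalemxAr mxE -/(coef i _) coef_col eq_sym (negbTE ji) mulr0.
Qed.

Let coef_ge0 x (i : 'I_3) : cchamber a x -> 0 <= coef i (homog x).
Proof.
move=> ax; rewrite leNgt; apply/negP => neg.
have b0 : 0 < coef i (homog b) by apply/(coneE _).1/cone_homog.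
have d0 : 0 < coef i (homog b) - coef i (homog x) by rewrite subr_gt0 (lt_trans neg).
(* On the segment to the interior point, the coefficient would vanish at time [t]. *)
pose t := - coef i (homog x) / (coef i (homog b) - coef i (homog x)).
have t01 : 0 < t <= 1.
  by rewrite divr_gt0 ?oppr_gt0 //= ler_pdivrMr // mul1r lerDr ltW.
have /cone_homog/coneE/(_ i) := chamber_segment ax ab t01.
rewrite homog_along coefD -scaleN1r coefD mulN1r /t.
by rewrite divfK ?gt_eqF // subrr ltxx.
Qed.

Let face_zero (h : 'cV[R]_3 -> R) x (i : 'I_3) :
    (forall (y z : 'cV[R]_3) t, h (y + t *: z) = h y + t * h z) ->
    (forall y : 'cV[R]_3, cone a y -> 0 < h y) -> cchamber a x -> h (homog x) = 0 ->
  0 < coef i (homog x) -> h (col i w) = 0.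
Proof.
move=> hD h0 ax hx ci; apply/eqP/negPn/negP => hi.
have hb : 0 < h (homog b) by apply/h0/cone_homog.
(* The coefficients of the perturbed point are positive, though [h] vanishes there. *)
have bad r : `|r| <= coef i (homog x) -> r * h (col i w) < 0 -> False.
  move=> rle rh.
  pose s := - (r * h (col i w)) / h (homog b).
  have s0 : 0 < s by rewrite divr_gt0 // oppr_gt0.
  have : cone a (homog x + r *: col i w + s *: homog b).
    apply/coneE => j; rewrite !coefD coef_col.
    have jb : 0 < coef j (homog b) by apply/(coneE _).1/cone_homog.
    apply: ltr_wpDl; last exact: mulr_gt0.
    have [->|_] := eqVneq j i; last first.
      by rewrite mulr0 addr0 coef_ge0.
    by rewrite mulr1 addrC -lerBlDl sub0r (le_trans _ rle) // -normrN ler_norm.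
  by move/h0; rewrite !hD hx add0r /s divfK ?gt_eqF // subrr ltxx.
move: hi; rewrite neq_lt => /orP[hi|hi].
  by apply: (bad (coef i (homog x))); rewrite ?gtr0_norm // pmulr_rlt0.
by apply: (bad (- coef i (homog x))); rewrite ?normrN ?gtr0_norm // mulNr oppr_lt0 mulr_gt0.
Qed.

(** The corners of the polygon lie on the edges of its cone. A linear form that is
positive on the open cone and vanishes at the corner [x] vanishes on every
generator that contributes to [x]. Two independent walls meet at [x], so such a
generator is a multiple of [homog x]. *)
Lemma corner_col x : corner a x -> exists i : 'I_3, x = slice (col i w).
Proof.
move=> [ax [k [l [kl kx lx]]]].
have [i ci] : exists i : 'I_3, 0 < coef i (homog x).
  apply: contrapT => H; have : homog x ord_max 0 = 0.
    rewrite [homog x]coef_sum big1 ?mxE // => i _.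
    rewrite (_ : coef i _ = 0) ?scale0r //; apply: le_anti.
    by rewrite coef_ge0 // andbT leNgt; apply/negP => h; apply: H; exists i.
  by rewrite homog2 => /eqP; rewrite oner_eq0.
exists i; set z := col i w.
have tight m : lin m x \is a Num.int -> lin3 m z = lin m x * z ord_max 0.
  move=> mx; have lE : lin3 m (homog x) = lin m x by rewrite /lin3 homog0 homog1.
  have [h|/(floor_chamber ax) h] := eqVneq (lin m x) ((a m)%:~R + 1).
    apply/esym/eqP; rewrite -subr_eq0; apply/eqP.
    apply: (@face_zero (fun y : 'cV[R]_3 => lin m x * y ord_max 0 - lin3 m y) x) ci => //.
    - by move=> y y' t; rewrite /lin3 !mxE; ring.
    - by move=> y /coneP[_ /(_ m)/andP[_]]; rewrite h subr_gt0.
    - by rewrite homog2 mulr1 lE subrr.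
  have {}h : lin m x = (a m)%:~R by rewrite -h floorK.
  apply/eqP; rewrite -subr_eq0; apply/eqP.
  apply: (@face_zero (fun y : 'cV[R]_3 => lin3 m y - lin m x * y ord_max 0) x) ci => //.
  - by move=> y y' t; rewrite /lin3 !mxE; ring.
  - by move=> y /coneP[_ /(_ m)/andP[]]; rewrite h subr_gt0.
  - by rewrite homog2 mulr1 lE subrr.
have E : (z 0 0, z 1 0) = (z ord_max 0 * x.1, z ord_max 0 * x.2).
  apply: (lin_inj kl).
    by have := tight k kx; rewrite /lin3 /lin /= => ->; ring.
  by have := tight l lx; rewrite /lin3 /lin /= => ->; ring.
case: E => E0 E1; rewrite /slice E0 E1.
have z0 : z ord_max 0 != 0.
  apply/eqP => z0; have : coef i z = 0.
    have -> : z = 0 by apply: col3P; rewrite [RHS]mxE ?E0 ?E1 z0 ?mul0r.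
    by rewrite /coef mulmx0 mxE.
  by rewrite coef_col eqxx => /eqP; rewrite oner_eq0.
by rewrite ![z _ _ * _]mulrC !mulfK // -surjective_pairing.
Qed.

End SimplicialCone.

Definition unique_side a := forall b x b' x', vertex x -> vertex x' ->
  side b x = a -> side b' x' = a -> (b, x) = (b', x').

(** The two labels differ by 1 at every family with a wall through [x]. *)
Lemma side_inj b b' x : vertex x -> side b x = side b' x -> b = b'.
Proof.
move=> [k [_ [_ kx _]]] E; have := congr1 (fun f => f k) E; rewrite /side /label ceil_floor kx.
by case: b {E} => //; case: b' => //; move: (Num.floor _) => m; lia.
Qed.

Lemma extremes_neq a b l r : chamber a b -> extremal 1 a l -> extremal (-1) a r -> l != r.
Proof.
move=> ab el er; apply/eqP => lr; rewrite -lr in er.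
have [y ay /eqP[]] := sweep_nonconst (sweep l) ab.
apply: le_anti; have := el.2 _ ay; rewrite !mul1r => ->; rewrite andbT.
by have := er.2 _ ay; rewrite !mulN1r lerN2.
Qed.

(** A cone with three generators leaves room for three corners. Two of them are
the leftmost and the rightmost one, so two different side corners are too many. *)
Lemma simplicial_unique_side a b : chamber a b ->
  open_simplicial_cone (cone a) -> unique_side a.
Proof.
move=> ab [w wU cw] c x c' x' vx vx' E E'.
have [l el] := extremal_exists 1 ab; have [r er] := extremal_exists (-1) ab.
have lr := extremes_neq ab el er.
have lx z d : side d z = a -> l != z.
  move=> zE; apply/eqP => lz; rewrite lz in el.
  by apply: extremal_not_side el zE; rewrite oner_eq0.
have rx z d : side d z = a -> r != z.
  move=> zE; apply/eqP => rz; rewrite rz in er.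
  by apply: extremal_not_side er zE; rewrite oppr_eq0 oner_eq0.
have [il hl] := corner_col ab wU cw el.1; have [ir hr] := corner_col ab wU cw er.1.
have [ix hx] : exists i : 'I_3, x = slice (col i w).
  by apply: (corner_col ab wU cw); rewrite -E; apply: side_corner.
have [ix' hx'] : exists i : 'I_3, x' = slice (col i w).
  by apply: (corner_col ab wU cw); rewrite -E'; apply: side_corner.
have xx : x = x'.
  apply/eqP/negPn/negP => xx.
  have := max_card [in [:: il; ir; ix; ix']]; rewrite card_ord.
  have /card_uniqP-> // : uniq [:: il; ir; ix; ix'].
  have ne z z' (i j : 'I_3) : z != z' -> z = slice (col i w) -> z' = slice (col j w) -> i != j.
    by move=> zz hz hz'; apply: contra zz => /eqP ij; rewrite hz hz' ij.
  rewrite /= !inE !negb_or (ne _ _ _ _ lr hl hr) (ne _ _ _ _ (lx _ _ E) hl hx).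
  rewrite (ne _ _ _ _ (lx _ _ E') hl hx') (ne _ _ _ _ (rx _ _ E) hr hx).
  by rewrite (ne _ _ _ _ (rx _ _ E') hr hx') (ne _ _ _ _ xx hx hx').
rewrite -xx in E' *; congr pair; apply: (side_inj vx); by rewrite E E'.
Qed.

Lemma barycentric A B C y : det2 (disp A B) (disp A C) != 0 ->
  y = ((det2 (disp B C) (disp B y) * A.1 + det2 (disp C A) (disp C y) * B.1
        + det2 (disp A B) (disp A y) * C.1) / det2 (disp A B) (disp A C),
       (det2 (disp B C) (disp B y) * A.2 + det2 (disp C A) (disp C y) * B.2
        + det2 (disp A B) (disp A y) * C.2) / det2 (disp A B) (disp A C)).
Proof.
rewrite /det2 /disp /=; case: A B C y => [a1 a2] [b1 b2] [c1 c2] [y1 y2] /= D.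
by congr pair; field.
Qed.

(** Barycentric coordinates are affine and nonnegative at the corners, hence
positive on the open chamber. Conversely, the linear inequalities that define
the chamber hold strictly on positive combinations of the corners. *)
Lemma triangle_simplicial a b (T : 'I_3 -> R * R) : chamber a b ->
  (forall i, corner a (T i)) -> (forall x, corner a x -> exists i, x = T i) ->
  T 0 != T 1 -> open_simplicial_cone (cone a).
Proof.
move=> ab cT Tc T01.
set A := T 0 in T01; set B := T 1 in T01; pose C := T ord_max.
pose D := det2 (disp A B) (disp A C).
have D0 : D != 0.
  apply/eqP => D0; have d0 : disp A B != (0, 0).
    apply: contra T01; rewrite [A]surjective_pairing [B]surjective_pairing !xpair_eqE.
    by rewrite !subr_eq0 eq_sym [B.2 == _]eq_sym.
  have [y /eqP] := det2_neq0 A d0; apply.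
  apply: (affine_zero (@affine_det2 _ _ A) ab) => x /Tc[i ->]; move: i.
  by apply: ord3_ind; rewrite -/A -/B -/C //; rewrite /det2 /disp /=; ring.
pose g (i : 'I_3) y := nth 0 [:: det2 (disp B C) (disp B y);
  det2 (disp C A) (disp C y); det2 (disp A B) (disp A y)] i / D.
have ag i : affine_fun (g i).
  move=> x y t; rewrite /g; move: i; apply: ord3_ind => /=;
  by rewrite affine_det2 mulrDl !mulrA.
have gT i j : g i (T j) = (i == j)%:R.
  move: i; apply: ord3_ind; move: j; apply: ord3_ind; rewrite -/A -/B -/C /g /=;
  rewrite /D /det2 /disp /= in D0 *; field; exact: D0.
have g_gt0 i y : chamber a y -> 0 < g i y.
  move=> ay; apply: (affine_pos (y := T i) (ag i) ay); last by rewrite gT eqxx oner_eq0.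
  by move=> x /Tc[j ->]; rewrite gT ler0n.
pose w : 'M[R]_3 := \matrix_(i, j) homog (T j) i 0.
have wT j : col j w = homog (T j) by apply/colP => i; rewrite !mxE.
exists w.
  rewrite unitmxE unitfE.
  rewrite (_ : \det w = D) // det_mx33 !mxE /= -/A -/B -/C /D /det2 /disp /=; ring.
apply/seteqP; split=> y /=.
  move=> [y0 ay]; exists (fun i => y ord_max 0 * g i (slice y)).
    by move=> i; rewrite mulr_gt0 // g_gt0.
  rewrite {1}(sliceK (lt0r_neq0 y0)) sum3 !wT -/A -/B -/C.
  have := barycentric (slice y) D0.
  move: (y ord_max 0) (slice y) => r x E.
  apply: col3P; rewrite !mxE /= /g /= -!mulrA -!mulrDr; congr (_ * _).
  - by rewrite {1}E /= -/D; field.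
  - by rewrite {1}E /= -/D; field.
  - by rewrite /D /det2 /disp /= in D0 *; field.
move=> [c c0 ->]; apply/coneP.
have pos h : affine_fun h -> (forall x, corner a x -> 0 <= h x) -> 0 < h b ->
    0 < \sum_i c i * h (T i).
  move=> ah hT hb; have h0 i : 0 <= c i * h (T i) by rewrite mulr_ge0 ?hT // ltW.
  rewrite lt0r sumr_ge0 // andbT; apply/negP => /eqP/psumr_eq0P H.
  have : h b = 0.
    apply: (affine_zero ah ab) => x /Tc[i ->].
    by apply/eqP; have /eqP := H (fun i _ => h0 i) i isT; rewrite mulf_eq0 gt_eqF.
  by move=> hb0; rewrite hb0 ltxx in hb.
have sum3E j : (\sum_(i < 3) c i *: col i w) j 0 = \sum_i c i * homog (T i) j 0.
  by rewrite summxE; apply: eq_bigr => i _; rewrite wT mxE.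
have s1 : (\sum_(i < 3) c i *: col i w) ord_max 0 = \sum_i c i.
  by rewrite sum3E; apply: eq_bigr => i _; rewrite homog2 mulr1.
split; first by rewrite s1 sum3 !addr_gt0.
move=> k.
have s2 : lin3 k (\sum_(i < 3) c i *: col i w) = \sum_i c i * lin k (T i).
  rewrite /lin3 !sum3E !sum3 !homog0 !homog1 /lin; ring.
rewrite s1 s2; apply/andP; split; rewrite -subr_gt0.
  rewrite mulr_sumr -sumrB (eq_bigr (fun i => c i * (lin k (T i) - (a k)%:~R))).
    apply: (pos (fun x => lin k x - (a k)%:~R)).
    - by move=> x z t; rewrite lin_along lin_disp; ring.
    - by move=> x [/(_ k)/andP[h _] _]; rewrite subr_ge0.
    - by have /andP[h _] := ab k; rewrite subr_gt0.
  by move=> i _; ring.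
rewrite mulr_sumr -sumrB (eq_bigr (fun i => c i * ((a k)%:~R + 1 - lin k (T i)))).
  apply: (pos (fun x => (a k)%:~R + 1 - lin k x)).
  - by move=> x z t; rewrite lin_along lin_disp; ring.
  - by move=> x [/(_ k)/andP[_ h] _]; rewrite subr_ge0.
  - by have /andP[_ h] := ab k; rewrite subr_gt0.
by move=> i _; ring.
Qed.

Lemma unique_side_simplicial a b : chamber a b ->
  unique_side a -> open_simplicial_cone (cone a).
Proof.
move=> ab us.
have [l el] := extremal_exists 1 ab; have [r er] := extremal_exists (-1) ab.
have [c [x [vx xa]]] := side_exists ab.
(* The corners are the leftmost, the rightmost and the only side corner. *)
pose T (i : 'I_3) := nth x [:: l; r; x] i.
apply: (@triangle_simplicial a b T ab).
- case=> -[|[|[|//]]] hi; [exact: el.1|exact: er.1|rewrite -xa; exact: side_corner].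
- move=> z cz; have [ez|ez|[d zd]] := extremal_or_side cz.
  + by exists 0; apply: (extremal_uniq _ ez el); rewrite oner_eq0.
  + by exists 1; apply: (extremal_uniq _ ez er); rewrite oppr_eq0 oner_eq0.
  + by exists ord_max; case: (us _ _ _ _ vx cz.2 xa zd).
- exact: (extremes_neq ab el er).
Qed.

(** * Counting corners modulo the lattice *)

Section Periodicity.
Variable N : nat.
Hypothesis N_gt0 : (0 < N)%N.
Hypothesis cross_dvdN : forall i j, i != j -> (cross i j %| N%:Z)%Z.
Implicit Types (z : int * int) (X Y : 'I_N * 'I_N).

Definition linz i z : int := p i * z.1 + q i * z.2.
Definition transl x z : R * R := (x.1 + z.1%:~R, x.2 + z.2%:~R).
Definition grid X : R * R := ((X.1 : nat)%:R / N%:R, (X.2 : nat)%:R / N%:R).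

(** The families with a wall through [grid X], in a form that can be counted. *)
Definition through X : {set 'I_n} :=
  [set i | (N%:Z %| linz i ((X.1 : nat)%:Z, (X.2 : nat)%:Z))%Z].

Let N0 : N%:R != 0 :> R.
Proof. by rewrite pnatr_eq0 -lt0n. Qed.

Lemma throughP i X : (i \in through X) = (lin i (grid X) \is a Num.int).
Proof.
have E : lin i (grid X) * N%:R = (linz i ((X.1 : nat)%:Z, (X.2 : nat)%:Z))%:~R.
  by rewrite /lin /grid /linz /= intrD !intrM; field.
rewrite inE; apply/idP/idP => [/dvdzP[k kE]|/intrP[k kE]].
  apply/intrP; exists k; apply: (mulIf N0); rewrite E kE intrM //.
apply/dvdzP; exists k; apply/eqP; rewrite -(eqr_int R) -E kE intrM //.
Qed.

Lemma lin_transl i x z : lin i (transl x z) = lin i x + (linz i z)%:~R.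
Proof. by rewrite /lin /transl /linz /= intrD !intrM; ring. Qed.

Lemma lin_transl_int i x z :
  (lin i (transl x z) \is a Num.int) = (lin i x \is a Num.int).
Proof. by rewrite lin_transl rpredDr // intr_int. Qed.

Lemma vertex_transl x z : vertex x -> vertex (transl x z).
Proof. by move=> [i [j [ij ix jx]]]; exists i, j; rewrite !lin_transl_int. Qed.

Lemma label_transl s x z : label s (transl x z) = fun i => label s x i + linz i z.
Proof.
apply/funext => i; rewrite /label lin_transl floorDrz ?intr_int // ceilDrz ?intr_int //.
by rewrite intrKfloor intrKceil; case: (s i); rewrite // addrAC.
Qed.

Lemma linz_inj z z' : (forall i, linz i z = linz i z') -> z = z'.
Proof.
move=> H; have E i : lin i (z.1%:~R, z.2%:~R) = lin i (z'.1%:~R, z'.2%:~R).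
  by have := congr1 (fun k : int => k%:~R : R) (H i); rewrite /linz /lin /= !intrD !intrM.
have := lin_inj k01 (E k0) (E k1) => -[/eqP + /eqP].
by rewrite !eqr_int; case: z z' {H E} => z1 z2 [z1' z2'] /= /eqP-> /eqP->.
Qed.

(** By Cramer's rule a vertex on walls of the families [i] and [j] has coordinates
with denominator [cross i j], which divides [N]. *)
Lemma vertex_grid x : vertex x -> exists X z, x = transl (grid X) z.
Proof.
move=> [i [j [ij /intrP[k kE] /intrP[l lE]]]].
have /dvdzP[m mE] := cross_dvdN ij.
have c0 : (cross i j)%:~R != 0 :> R by rewrite intr_eq0 cross_neq0.
have NE : N%:R = (m%:~R * (cross i j)%:~R) :> R by rewrite -intrM -mE.
have e1 : x.1 * N%:R = (m * (q j * k - q i * l))%:~R.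
  by rewrite NE /cross mulrC -mulrA intrM; congr (_ * _); rewrite !(intrB, intrM) -kE -lE /lin; ring.
have e2 : x.2 * N%:R = (m * (p i * l - p j * k))%:~R.
  by rewrite NE /cross mulrC -mulrA intrM; congr (_ * _); rewrite !(intrB, intrM) -kE -lE /lin; ring.
have red (t : int) : exists (r : 'I_N) (c : int), t = (r : nat)%:Z + c * N%:Z.
  have Nz : N%:Z != 0 by rewrite eqz_nat -lt0n.
  have rlt : (`|(t %% N)%Z| < N)%N.
    by rewrite -ltz_nat gez0_abs ?modz_ge0 // ltz_pmod.
  exists (Ordinal rlt), (t %/ N)%Z => /=.
  by rewrite gez0_abs ?modz_ge0 // addrC -divz_eq.
have [r1 [c1 E1]] := red (m * (q j * k - q i * l)).
have [r2 [c2 E2]] := red (m * (p i * l - p j * k)).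
exists (r1, r2), (c1, c2); rewrite [x]surjective_pairing /transl /grid /=.
congr pair; apply: (mulIf N0); rewrite ?e1 ?e2 ?E1 ?E2 intrD intrM; field; exact: N0.
Qed.

Lemma transl_grid_inj X Y z z' : transl (grid X) z = transl (grid Y) z' -> X = Y.
Proof.
have red (r s : 'I_N) (c d : int) :
    (r : nat)%:R / N%:R + c%:~R = (s : nat)%:R / N%:R + d%:~R :> R -> r = s.
  move=> E; apply: val_inj => /=.
  have : (r : nat)%:Z + c * N%:Z = (s : nat)%:Z + d * N%:Z.
    apply/eqP; rewrite -(eqr_int R) !intrD !intrM; apply/eqP.
    have := congr1 (fun t => t * N%:R) E; rewrite /= !mulrDl !divfK //.
  move=> /(congr1 (fun t => (t %% N%:Z)%Z)).
  rewrite ![(_ : nat)%:Z + _]addrC !modzMDl !modz_small ?ltz_nat ?ltn_ord //; first by case.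
by case: X Y => X1 X2 [Y1 Y2] [/red-> /red->].
Qed.

(** The side corner [s] and the leftmost corner [r] belong to the same chamber, up
to a lattice translation. *)
Definition shares_chamber (s : ('I_N * 'I_N) * bool) (r : ('I_N * 'I_N) * 'I_n) :=
  exists z, below r.2 (transl (grid r.1) z) = side s.2 (grid s.1).

Definition side_corners : {set ('I_N * 'I_N) * bool} := [set s | (1 < #|through s.1|)%N].

(** A leftmost corner on the torus is recorded with the wall through it that bounds
its chamber from above. Every wall through the vertex occurs except the least
steep one, since the chamber below it has the vertex as a side corner. *)
Definition left_corners : {set ('I_N * 'I_N) * 'I_n} :=
  [set r | (r.2 \in through r.1) && [exists j in through r.1, 0 < cross r.2 j]].

Lemma vertex_through X : vertex (grid X) <-> (1 < #|through X|)%N.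
Proof.
split=> [[i [j [ij ix jx]]]|/card_gt1P[i [j [ix jx ij]]]].
  by apply/card_gt1P; exists i, j; rewrite !throughP.
by exists i, j; rewrite -!throughP.
Qed.

Lemma exists_left_corner s : s \in side_corners -> exists2 r, r \in left_corners & shares_chamber s r.
Proof.
case: s => X b; rewrite inE /= => vX.
have [y ay _] := side_chamber b (grid X).
have [x [i [j [ix jx c0 xE]]]] := below_exists ay.
have ij : i != j by apply: contraTN c0 => /eqP->; rewrite /cross mulrC subrr ltxx.
have [|Y [z yE]] := @vertex_grid x; first by exists i, j.
exists (Y, i); last by exists z; rewrite /= -yE.
rewrite inE /= throughP -(lin_transl_int _ _ z) -yE ix /=.
by apply/existsP; exists j; rewrite throughP -(lin_transl_int _ _ z) -yE jx.
Qed.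

Let opp z : int * int := (- z.1, - z.2).
Let add z z' : int * int := (z.1 + z'.1, z.2 + z'.2).

Let linz_opp i z : linz i (opp z) = - linz i z.
Proof. by rewrite /linz /opp /=; ring. Qed.

Let linz_add i z z' : linz i (add z z') = linz i z + linz i z'.
Proof. by rewrite /linz /add /=; ring. Qed.

Lemma exists_side_corner r : r \in left_corners -> exists2 s, s \in side_corners & shares_chamber s r.
Proof.
case: r => Y i; rewrite inE /= => /andP[iY /existsP[j /andP[jY c0]]].
have [y ay] := below_chamber i (grid Y).
have [b [x [vx xE]]] := side_exists ay.
have [X [z yE]] := vertex_grid vx.
exists (X, b).
  rewrite inE /= -vertex_through.
  move: vx => [k [l [kl kx lx]]]; exists k, l.
  by rewrite -(lin_transl_int _ _ z) -(lin_transl_int l _ z) -yE.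
exists (opp z) => /=; rewrite /below label_transl -/(below _ _) -xE yE /side label_transl.
by apply/funext => k; rewrite linz_opp addrK.
Qed.

Lemma left_extremal Y i z : (Y, i) \in left_corners ->
  extremal 1 (below i (transl (grid Y) z)) (transl (grid Y) z).
Proof.
rewrite inE /= => /andP[iY /existsP[j /andP[jY c0]]].
by apply: (@below_extremal i j) => //; rewrite lin_transl_int -throughP.
Qed.

Lemma shares_chamber_functional s r r' : r \in left_corners -> r' \in left_corners ->
  shares_chamber s r -> shares_chamber s r' -> r = r'.
Proof.
case: r r' => Y i [Y' i'] rL rL' [z /= zE] [z' /= zE'].
have e := left_extremal z rL; have e' := left_extremal z' rL'.
rewrite zE in e; rewrite zE' in e'.
have yy := extremal_uniq (oner_neq0 _) e e'.
have YY := transl_grid_inj yy; congr pair => //.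
apply: (@below_inj (transl (grid Y) z)).
- by move: rL; rewrite inE /= lin_transl_int -throughP => /andP[].
- by move: rL'; rewrite inE /= yy lin_transl_int -throughP => /andP[].
- by rewrite zE yy zE'.
Qed.

(** Translate both side corners into the chamber whose leftmost corner is the
chosen representative. *)
Lemma unique_side_inj s s' r :
  (forall a b, chamber a b -> unique_side a) ->
  s \in side_corners -> s' \in side_corners ->
  shares_chamber s r -> shares_chamber s' r -> s = s'.
Proof.
case: s s' r => X b [X' b'] [Y i] us sS sS' [z /= zE] [z' /= zE'].
have [y ay] := below_chamber i (grid Y).
have back c W w : below i (transl (grid Y) w) = side c (grid W) ->
    side c (transl (grid W) (opp w)) = below i (grid Y).
  move=> E; rewrite /side label_transl -/(side _ _) -E /below label_transl.
  by apply/funext => k; rewrite linz_opp addrK.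
rewrite inE /= -vertex_through in sS; rewrite inE /= -vertex_through in sS'.
have := us _ _ ay _ _ _ _ (vertex_transl (opp z) sS) (vertex_transl (opp z') sS')
   (back _ _ _ zE) (back _ _ _ zE').
by case=> -> h1 h2; rewrite (@transl_grid_inj X X' (opp z) (opp z')) // /transl h1 h2.
Qed.

(** If two side corners of one chamber have the same class on the torus, they differ
by a lattice translation that fixes the label of the chamber. Such a translation
is trivial, since the [v_i] span the plane. *)
Lemma inj_unique_side :
  (forall s s' r, s \in side_corners -> s' \in side_corners -> r \in left_corners ->
     shares_chamber s r -> shares_chamber s' r -> s = s') ->
  forall a b, chamber a b -> unique_side a.
Proof.
move=> inj a y ay b x b' x' vx vx' xE xE'.
have [X [z zE]] := vertex_grid vx; have [X' [z' zE']] := vertex_grid vx'.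
have vX c w W W' : vertex W -> W = transl (grid W') w -> (W', c) \in side_corners.
  move=> [k [l [kl kx lx]]] WE; rewrite inE -vertex_through; exists k, l.
  by rewrite -(lin_transl_int _ _ w) -(lin_transl_int l _ w) -WE.
have sS := vX b _ _ _ vx zE; have sS' := vX b' _ _ _ vx' zE'.
have [[Y i] rL sh] := exists_left_corner sS.
have E : (X, b) = (X', b').
  apply: (inj _ _ _ sS sS' rL sh); case: sh => w /= wE.
  exists (add w (add z (opp z'))) => /=; apply/funext => k.
  have := congr1 (fun f => f k) xE; have := congr1 (fun f => f k) xE'.
  have := congr1 (fun f => f k) wE.
  rewrite zE zE' /side /below !label_transl !linz_add linz_opp => h1 h2 h3.
  by rewrite addrA h1 addrA h3 -h2 addrK.
case: E => XX bb; rewrite -XX -bb in zE' xE' *; congr pair.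
rewrite zE zE'; congr transl; apply: linz_inj => k.
have := congr1 (fun f => f k) xE; have := congr1 (fun f => f k) xE'.
by rewrite zE zE' /side !label_transl => <- /addrI.
Qed.

(** Sending a side corner to the leftmost corner of its chamber is a surjection
between finite sets; it is injective iff the cardinalities agree. *)
Lemma unique_side_card : (forall a b, chamber a b -> unique_side a) <->
  #|left_corners| = #|side_corners|.
Proof.
have ex s : exists r, s \in side_corners -> r \in left_corners /\ shares_chamber s r.
  have [sS|] := boolP (s \in side_corners); last by exists (s.1, k0).
  by have [r rL sr] := exists_left_corner sS; exists r.
have [f fP] := choice ex.
have imf : left_corners = f @: side_corners.
  apply/setP => r; apply/idP/imsetP => [rL|[s sS ->]]; last by case: (fP s sS).
  have [s sS sr] := exists_side_corner rL; exists s => //.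
  by have [fL sf] := fP s sS; exact: (shares_chamber_functional rL fL sr sf).
rewrite imf; split=> [us|/eqP/imset_injP inj].
  apply/eqP/imset_injP => s s' sS sS' ff.
  have [fL sf] := fP s sS; have [fL' sf'] := fP s' sS'; rewrite -ff in sf'.
  exact: (unique_side_inj us sS sS' sf sf').
apply: inj_unique_side => s s' r sS sS' rL sr sr'; apply: inj => //.
have [fL sf] := fP s sS; have [fL' sf'] := fP s' sS'.
by rewrite -(shares_chamber_functional rL fL sr sf) -(shares_chamber_functional rL fL' sr' sf').
Qed.

Lemma card_side_corners : #|side_corners| = (\sum_X (1 < #|through X|) * 2)%N.
Proof.
rewrite -sum1_card big_mkcond /= (eq_bigr (fun s => (1 < #|through s.1|) * 1)%N).
  by rewrite -(pair_bigA _ (fun X (b : bool) => (1 < #|through X|) * 1)%N) /=;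
     apply: eq_bigr => X _; rewrite sum_nat_const card_bool muln1 mulnC.
by move=> s _; rewrite inE muln1; case: ifP.
Qed.

Lemma card_left_corners : #|left_corners| = (\sum_X #|through X|.-1)%N.
Proof.
rewrite -sum1_card big_mkcond /=.
rewrite (eq_bigr (fun s => if (s.1, s.2) \in left_corners then 1 else 0)%N); last by case.
rewrite -(pair_bigA _ (fun X i => if (X, i) \in left_corners then 1 else 0)%N) /=.
apply: eq_bigr => X _; rewrite -big_mkcond sum1_card /=.
have [M0|[i0 i0M]] := set_0Vmem (through X).
  by rewrite M0 cards0; apply: eq_card0 => i; rewrite [LHS]inE /= M0 inE.
case: (@arg_maxP _ R _ i0 (fun i => i \in through X) descent) => // i iM imax.
rewrite (cardsD1 i (through X)) iM add1n /=; apply: eq_card => j.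
rewrite [LHS]inE /= [RHS]inE inE andbC.
case jM: (j \in through X); rewrite ?andbF // !andbT.
have anti : cross i j = - cross j i by rewrite /cross; ring.
apply/existsP/idP => [[k /andP[kM]]|ji].
  by apply: contraTneq => ->; rewrite -descent_lt -leNgt; exact: imax.
exists i; rewrite iM; have := cross_neq0 ji; rewrite neq_lt => /orP[c0|//].
have := imax _ jM; rewrite /= leNgt descent_lt anti oppr_gt0 c0 //.
Qed.

End Periodicity.

End Strips.

(** * Connected components of the complement *)

Section Components.
Variables (R : realType) (n : nat) (v : 'I_n -> 'cV[int]_2).
Implicit Types (y z : 'cV[R]_3) (a : 'I_n -> int).

Let p i : int := v i 0 0.
Let q i : int := v i 1 0.
Let wall i (k : int) y : R := lin3 p q i y + k%:~R * y ord_max 0.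
Let arrangement := toric_arrangement (fun i => map_mx (fun z : int => z%:~R : R) (v i)).
Let D := half_space_complement arrangement.

Lemma perp_wall i k :
  perp (embed_plane (map_mx (fun z : int => z%:~R : R) (v i)) + k%:~R *: e3 R)
  = [set y | wall i k y = 0].
Proof.
apply/seteqP; split=> y /=; rewrite /perp /= /wall /lin3 /inner sum3 !mxE /=;
by rewrite !(mulr0, mulr1, addr0, add0r).
Qed.

Lemma perp_e3 : perp (e3 R) = [set y | y ord_max 0 = 0].
Proof.
apply/seteqP; split=> y /=; rewrite /perp /= /inner sum3 !mxE /=;
by rewrite !(mul0r, mul1r, addr0, add0r).
Qed.

Lemma complementE y : D y <-> 0 < y ord_max 0 /\ forall i k, wall i k y <> 0.
Proof.
split=> [[y0 H]|[y0 H]]; split=> //.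
  move=> i k yw; apply: H; exists [set z | wall i k z = 0] => //.
  by left; exists i, k; rewrite perp_wall.
move=> [_ [[i [k ->]]|->]]; first by rewrite perp_wall => /H.
by rewrite perp_e3 /= => y1; have := y0; rewrite /open_half_space /= y1 ltxx.
Qed.

Lemma complement_label y : D y ->
  cone p q (fun i => Num.floor (lin p q i (slice y))) y.
Proof.
move=> /complementE[y0 H]; split=> // i.
have /andP[h1 h2] := floor_itv (lin p q i (slice y)); rewrite intrD1 in h2.
rewrite h2 lt_neqAle h1 !andbT; apply/eqP => E.
apply: (H i (- Num.floor (lin p q i (slice y)))).
rewrite /wall mulrNz E /lin3 /lin /slice /=; field; exact: lt0r_neq0.
Qed.

Lemma cone_complement a y : cone p q a y -> D y.
Proof.
move=> /coneP[y0 H]; apply/complementE; split=> // i k w0.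
have := H i; have -> : lin3 p q i y = (- k)%:~R * y ord_max 0.
  by apply/eqP; rewrite mulrNz mulNr -subr_eq0 opprK; apply/eqP.
rewrite !ltr_pM2r // -intrD1 !ltr_int; lia.
Qed.

Let continuous_linear (al be ga : R) :
  continuous (fun y : 'cV[R]_3 => al * y 0 0 + be * y 1 0 + ga * y ord_max 0).
Proof.
have c k i : continuous (fun y : 'cV[R]_3 => k * y i 0).
  by move=> y; apply: continuousM; [exact: cst_continuous|exact: coord_continuous].
have cD (f g : 'cV[R]_3 -> R) : continuous f -> continuous g ->
    continuous (fun y => f y + g y).
  by move=> cf cg y; apply: continuousD; [exact: cf|exact: cg].
by apply: (cD _ (fun y => ga * y ord_max 0)) => //; exact: cD.
Qed.

(** The cone is convex, hence connected. A larger connected subset of the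
complement would leave one of the strips, but a strip is relatively closed and
open in the complement, because its bounding planes belong to the
arrangement. *)
Lemma cone_component a y : cone p q a y -> connected_component D y = cone p q a.
Proof.
move=> ay; apply/seteqP; split=> z.
  move=> [B [By BD Bc] Bz].
  have Bpos x : B x -> 0 < x ord_max 0 by move=> /BD/complementE[].
  apply/coneP; split; first exact: Bpos.
  move=> i.
  pose lo (x : 'cV[R]_3) : R := lin3 p q i x - (a i)%:~R * x ord_max 0.
  pose hi (x : 'cV[R]_3) : R := ((a i)%:~R + 1) * x ord_max 0 - lin3 p q i x.
  have clo : continuous lo.
    have -> : lo = (fun x : 'cV[R]_3 => (p i)%:~R * x 0 0 + (q i)%:~R * x 1 0 + - (a i)%:~R * x ord_max 0).
      by apply/funext => x; rewrite /lo /lin3; ring.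
    exact: continuous_linear.
  have chi : continuous hi.
    have -> : hi = (fun x : 'cV[R]_3 => - (p i)%:~R * x 0 0 + - (q i)%:~R * x 1 0 + ((a i)%:~R + 1) * x ord_max 0).
      by apply/funext => x; rewrite /hi /lin3; ring.
    exact: continuous_linear.
  have lo0 x : B x -> lo x <> 0.
    move=> /BD/complementE[_ /(_ i (- a i))]; rewrite /wall mulrNz mulNr /lo; exact.
  have hi0 x : B x -> hi x <> 0.
    move=> /BD/complementE[_ /(_ i (- (a i + 1)))] + h; apply.
    by rewrite /wall mulrNz intrD1 mulNr; apply/eqP; rewrite subr_eq0 eq_sym -subr_eq0; apply/eqP.
  (* The points of [B] inside the strip of family [i]. *)
  have S : B `&` [set x | 0 < lo x /\ 0 < hi x] = B.
    apply: Bc.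
    - exists y; split=> //=; have /coneP[_ /(_ i)] := ay.
      by rewrite /lo /hi !subr_gt0 => /andP[].
    - exists [set x | 0 < lo x /\ 0 < hi x] => //.
      apply: openI; apply: (@open_comp _ _ _ [set r : R | 0 < r]); try exact: open_gt;
      by move=> ? _; auto.
    - exists [set x | 0 <= lo x /\ 0 <= hi x].
        apply: closedI; apply: (@closed_comp _ _ _ [set r : R | 0 <= r]); try exact: closed_ge;
        by move=> ? _; auto.
      apply/seteqP; split=> x [Bx [h1 h2]]; split=> //; split; try exact: ltW.
        by rewrite lt0r h1 andbT; apply/eqP/lo0.
      by rewrite lt0r h2 andbT; apply/eqP/hi0.
  by move: Bz; rewrite -S => -[_ []]; rewrite /lo /hi !subr_gt0 => -> ->.
move=> az.
pose seg (t : R) := y + t *: (z - y).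
have segC : connected (seg @` `[0, 1]).
  apply: connected_continuous_connected; first exact: segment_connected.
  apply: continuous_subspaceT => t; apply: cvgD; first exact: cvg_cst.
  exact: scalel_continuous.
exists (seg @` `[0, 1]); last first.
  by exists 1; [rewrite /= in_itv /= ler01 lexx|rewrite /seg scale1r addrC subrK].
split=> //.
  by exists 0; [rewrite /= in_itv /= ler01 lexx|rewrite /seg scale0r addr0].
move=> _ [t /= + <-]; rewrite in_itv /= => /andP[t0 t1].
apply: (@cone_complement a); apply/coneP.
have [y0 hy] := (coneP p q a y).1 ay; have [z0 hz] := (coneP p q a z).1 az.
have s0 : 0 <= 1 - t by rewrite subr_ge0.
have mix (A B : R) : 0 < A -> 0 < B -> 0 < (1 - t) * A + t * B.
  by move=> A0 B0; move: t0; rewrite le_eqVlt => /orP[/eqP<-|t0']; nra.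
have segE i : seg t i 0 = (1 - t) * y i 0 + t * z i 0.
  by rewrite /seg !mxE; ring.
rewrite segE; split; first exact: mix.
move=> i; have /andP[h1 h2] := hy i; have /andP[h3 h4] := hz i.
rewrite -subr_gt0 in h1; rewrite -subr_gt0 in h2.
rewrite -subr_gt0 in h3; rewrite -subr_gt0 in h4.
apply/andP; split; rewrite -subr_gt0.
  have := mix _ _ h1 h3; congr (0 < _); rewrite /lin3 !segE; ring.
have := mix _ _ h2 h4; congr (0 < _); rewrite /lin3 !segE; ring.
Qed.

Lemma simplicial_cones : simplicial arrangement <->
  forall a (x : R * R), chamber p q a x -> open_simplicial_cone (cone (R := R) p q a).
Proof.
split=> [H a x ax|H y Dy].
  have ay : cone p q a (homog x) by exact/cone_homog.
  by rewrite -(cone_component ay); apply/H/(cone_complement ay).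
have ay := complement_label Dy.
by rewrite (cone_component ay); case: ay => _; exact: H.
Qed.

End Components.

(** * Inclusion-exclusion over the vertices of the torus *)

Section InclusionExclusion.
Variables (n : nat) (v : 'I_n -> 'cV[int]_2).
Let p i : int := v i 0 0.
Let q i : int := v i 1 0.

Lemma pluckerE i j : plucker v i j = cross p q i j.
Proof.
rewrite mxE det_mx22 /cross.
have l (k : 'I_2) : (row_mx (v i) (v j) : 'M[int]_2) k 0 = v i k 0.
  by rewrite mxE; case: splitP => // h _; rewrite ord1.
have r (k : 'I_2) : (row_mx (v i) (v j) : 'M[int]_2) k 1 = v j k 0.
  by rewrite mxE; case: splitP => [[[]]|h _] //; rewrite ord1.
by rewrite !l !r /p /q; ring.
Qed.

Hypothesis cross_neq0 : forall i j, i != j -> cross p q i j != 0.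
Hypothesis n1 : (1 < n)%N.

(** A common multiple of all the gcds involved: every vertex of the arrangement has
coordinates in [1 / period], and every [vol v S] with [#|S| >= 2] divides it. *)
Definition period : nat :=
  (\prod_(ij : 'I_n * 'I_n | ij.1 != ij.2) absz (cross p q ij.1 ij.2))%N.

Lemma period_gt0 : (0 < period)%N.
Proof. by apply: prodn_cond_gt0 => ij /cross_neq0; rewrite absz_gt0. Qed.

Lemma cross_dvd_period i j : i != j -> (cross p q i j %| period%:Z)%Z.
Proof. by move=> ij; rewrite dvdzE absz_nat /period (bigD1 (i, j)) //= dvdn_mulr. Qed.

Lemma dvdn_vol (S : {set 'I_n}) e :
  (e %| vol v S)%N <-> forall i j, i \in S -> j \in S -> (e%:Z %| cross p q i j)%Z.
Proof.
split=> [/dvdn_biggcdP H i j iS jS|H].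
  by have /dvdn_biggcdP/(_ j jS) := H i iS; rewrite pluckerE dvdzE absz_nat.
apply/dvdn_biggcdP => i iS; apply/dvdn_biggcdP => j jS.
by rewrite pluckerE; have := H i j iS jS; rewrite dvdzE absz_nat.
Qed.

Lemma vol_card (S : {set 'I_n}) : (1 < #|S|)%N ->
  vol v S = #|[set X : 'I_period * 'I_period | S \subset through p q X]%SET|.
Proof.
move=> /card_gt1P[i0 [j0 [i0S j0S ij0]]].
pose A : 'M[int]_(n, 2) := \matrix_(i, j) (if i \in S then v i j 0 else 0).
have A_minor i j : minor A i j = if (i \in S) && (j \in S) then cross p q i j else 0.
  rewrite /minor !mxE /cross; case: (i \in S); case: (j \in S) => /=; rewrite ?mulr0 ?mul0r ?subrr //.
rewrite -[LHS](@card_solutions n A period (vol v S)) //.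
- apply: eq_card => X; rewrite !inE; apply/forallP/fintype.subsetP => [H i iS|H i].
    have := H i; rewrite inE /linz; congr (_ %| _)%Z.
    by rewrite mxE sum2 !mxE iS.
  have [iS|iS] := boolP (i \in S); last by rewrite mxE sum2 !mxE (negbTE iS) !mul0r.
  have := H i iS; rewrite inE /linz; congr (_ %| _)%Z.
  by rewrite mxE sum2 !mxE iS.
- exact: period_gt0.
- have /dvdn_vol/(_ _ _ i0S j0S) := dvdnn (vol v S).
  by move/dvdz_trans/(_ (cross_dvd_period ij0)).
- move=> e; split=> [/dvdn_vol H i j|H].
    by rewrite A_minor; case: ifP => [/andP[]|_]; [exact: H|exact: dvdz0].
  by apply/dvdn_vol => i j iS jS; have := H i j; rewrite A_minor iS jS.
Qed.

Lemma sum_vol :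
  \sum_(2 <= k < n.+1) \sum_(S : {set 'I_n} | #|S| == k)
     (-1) ^+ k.+1 * (2 * k%:Z - 3) * (vol v S)%:Z
  = \sum_(X : 'I_period * 'I_period)
      (if (1 < #|through p q X|)%N then #|through p q X|%:Z - 3 else 0) :> int.
Proof.
under [RHS]eq_bigr => X _.
  rewrite -(@weighted_subsets _ n) //; last by rewrite -[leqRHS]card_ord max_card.
  over.
rewrite exchange_big /= big_nat_cond [RHS]big_nat_cond; apply: eq_bigr => k.
rewrite andbT => /andP[k2 _]; rewrite -!mulr_sumr; congr (_ * _).
rewrite (eq_bigr (fun S : {set 'I_n} => \sum_(X : 'I_period * 'I_period) (S \subset through p q X)%:Z)); last first.
  move=> S /eqP Sk; rewrite vol_card ?Sk // -sum1_card big_mkcond /=.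
  rewrite -natz natr_sum; apply: eq_bigr => X _; rewrite inE.
  by case: (S \subset _).
rewrite exchange_big /=; apply: eq_bigr => X _.
rewrite -cards_draws -sum1_card -natz natr_sum big_mkcond [RHS]big_mkcond /=.
by apply: eq_bigr => S _; rewrite inE andbC; case: (#|S| == k); case: (S \subset _).
Qed.

End InclusionExclusion.

Section Orientation.
Variables (R : realType) (n : nat).
Implicit Types v w : 'I_n -> 'cV[int]_2.

(** The two cardinalities compared by [unique_side_card] are the sums over the
torus of [m - 1] and of [2] for each vertex on [m] lines; their difference is
the sum of [m - 3]. *)
Lemma oriented_simplicial v (u : R * R) : (1 < n)%N ->
  (forall i j, i != j -> plucker v i j != 0) ->
  (forall i, 0 < lin (fun i => v i 0 0) (fun i => v i 1 0) i u) ->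
  simplicial (toric_arrangement (fun i => map_mx (fun z : int => z%:~R : R) (v i)))
  <->
  \sum_(2 <= k < n.+1) \sum_(S : {set 'I_n} | #|S| == k)
     (-1) ^+ k.+1 * (2 * k%:Z - 3) * (vol v S)%:Z = 0 :> int.
Proof.
move=> n1 hv u_pos.
set p := fun i => v i 0 0 in u_pos; set q := fun i => v i 1 0 in u_pos.
have c0 i j : i != j -> cross p q i j != 0 by rewrite -pluckerE; exact: hv.
pose k0 : 'I_n := Ordinal (ltnW n1); pose k1 : 'I_n := Ordinal n1.
have k01 : k0 != k1 by [].
have N0 := period_gt0 c0; have Nd := @cross_dvd_period _ v.
have US := unique_side_card c0 k01 u_pos N0 Nd.
rewrite sum_vol //; apply: (iff_trans (simplicial_cones R v)).
have step1 : (forall a (x : R * R), chamber p q a x -> open_simplicial_cone (cone (R := R) p q a))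
    <-> (forall a (x : R * R), chamber p q a x -> unique_side R p q a).
  split=> H a x ax; have := H a x ax.
    exact: (simplicial_unique_side c0 k01 u_pos ax).
  exact: (unique_side_simplicial c0 k01 u_pos ax).
apply: (iff_trans step1); apply: (iff_trans US).
rewrite (card_left_corners c0 k0 u_pos) card_side_corners.
have -> : \sum_(X : 'I_(period v) * 'I_(period v))
      (if (1 < #|through p q X|)%N then #|through p q X|%:Z - 3 else 0)
  = (\sum_(X : 'I_(period v) * 'I_(period v)) #|through p q X|.-1)%N%:Z
    - (\sum_(X : 'I_(period v) * 'I_(period v)) (1 < #|through p q X|)%N * 2)%N%:Z :> int.
  rewrite -!natz !natr_sum -sumrB; apply: eq_bigr => X _; rewrite !natz.
  by case: #|_| => [|[|m]] //=; lia.
by split=> [->|/eqP]; [rewrite subrr|rewrite subr_eq0 => /eqP[]].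
Qed.

Lemma arrangement_sign v w : (forall i, w i = v i \/ w i = - v i) ->
  toric_arrangement (fun i => map_mx (fun z : int => z%:~R : R) (w i)) `<=`
  toric_arrangement (fun i => map_mx (fun z : int => z%:~R : R) (v i)).
Proof.
move=> vw H [[i [k ->]]|->]; last by right.
left; case: (vw i) => E; first by exists i, k; rewrite E.
exists i, (- k); rewrite !perp_wall; apply/seteqP; split=> y /=.
  by rewrite /lin3 E !mxE !mulrNz; lra.
by rewrite /lin3 E !mxE !mulrNz; lra.
Qed.

Lemma vol_sign v w S : (forall i, w i = v i \/ w i = - v i) -> vol w S = vol v S.
Proof.
move=> vw; rewrite /vol; apply: eq_bigr => i _; apply: eq_bigr => j _.
rewrite !pluckerE /cross.
case: (vw i) => ->; case: (vw j) => ->; rewrite ?mxE //.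
- by rewrite -[RHS]abszN; congr absz; ring.
- by rewrite -[RHS]abszN; congr absz; ring.
- by congr absz; ring.
Qed.

(** The direction [(1, K)] lies on no wall as soon as [K] exceeds all the first
coordinates. *)
Lemma exists_direction v : (1 < n)%N -> (forall i j, i != j -> plucker v i j != 0) ->
  exists K : int, forall i, v i 0 0 + K * v i 1 0 != 0.
Proof.
move=> n1 hv; pose K : nat := (1 + \sum_i absz (v i 0%R 0%R))%N.
exists K%:Z => i; have iK : (absz (v i 0%R 0%R) < K)%N.
  by rewrite /K (bigD1 i) //= add1n ltnS leq_addr.
have [j ij] : exists j, i != j.
  have [->|] := eqVneq i (Ordinal n1); last by exists (Ordinal n1).
  by exists (Ordinal (ltnW n1)).
apply/eqP => E; have := hv i j ij; rewrite pluckerE /cross.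
have q0 : v i 1 0 = 0 by nia.
by move: E; rewrite q0 mulr0 addr0 => ->; rewrite !mul0r subrr.
Qed.

End Orientation.

Theorem theorem1p1 (R : realType) (n : nat) (v : 'I_n -> 'cV[int]_2)
  (hn : (2 <= n)%N)
  (hv : forall i j : 'I_n, i != j -> plucker v i j != 0) :
  simplicial (toric_arrangement (fun i => map_mx (fun z : int => z%:~R : R) (v i)))
  <->
  \sum_(2 <= k < n.+1) \sum_(S : {set 'I_n} | #|S| == k)
     (-1) ^+ k.+1 * (2 * k%:Z - 3) * (vol v S)%:Z = 0 :> int.
Proof.
have [K Kne] := exists_direction hn hv.
(* Reversing some of the [v_i] changes neither the arrangement nor the gcds. *)
pose w i := if 0 < v i 0 0 + K * v i 1 0 then v i else - v i.
have wv i : w i = v i \/ w i = - v i by rewrite /w; case: ifP; [left|right].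
have vw i : v i = w i \/ v i = - w i.
  by case: (wv i) => ->; [left|right; rewrite opprK].
have -> : toric_arrangement (fun i => map_mx (fun z : int => z%:~R : R) (v i)) =
          toric_arrangement (fun i => map_mx (fun z : int => z%:~R : R) (w i)).
  by apply/seteqP; split; apply: arrangement_sign.
have -> : \sum_(2 <= k < n.+1) \sum_(S : {set 'I_n} | #|S| == k)
     (-1) ^+ k.+1 * (2 * k%:Z - 3) * (vol v S)%:Z =
   \sum_(2 <= k < n.+1) \sum_(S : {set 'I_n} | #|S| == k)
     (-1) ^+ k.+1 * (2 * k%:Z - 3) * (vol w S)%:Z :> int.
  by apply: eq_bigr => k _; apply: eq_bigr => S _; rewrite (vol_sign S wv).
apply: (@oriented_simplicial _ _ w (1, K%:~R)) => // [i j /hv|i].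
  rewrite !pluckerE /cross.
  have flip (x y : int) : y = x \/ y = - x -> x != 0 -> y != 0.
    by case=> ->; rewrite ?oppr_eq0.
  apply: flip; case: (wv i) => ->; case: (wv j) => ->; rewrite ?mxE;
    first [by left; ring | by right; ring].
rewrite /lin /= mulr1 -intrM -intrD ltr0z /w.
case: ifPn => [|]; first by rewrite mulrC.
rewrite -leNgt le_eqVlt (negbTE (Kne i)) /= -oppr_gt0 => h.
by rewrite !mxE mulNr mulrC -opprD.
Qed.
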